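(* Let $m,\alpha,\beta\ge 1$ be integers with $2\nmid\alpha$, let $c_4(n)$ be defined by $$\sum_{n=0}^{\infty}c_4(n)q^n:=f_1f_2^{10},$$ and let $p\ge 3$ be a prime. Define $$\kappa(p):=c_4\left(\frac{7(p^2-1)}{8}\right)+p^4\left(\frac{-\frac74(p^2-1)}{p}\right)_L,$$ and $$\nu(p):=\begin{cases}4,&\text{if }\kappa(p)\equiv 0\pmod 2,\\ 6,&\text{if }\kappa(p)\equiv 1\pmod 2.\end{cases}$$ (1) For all integers $n,k\ge 0$ with $p\nmid n$, $$\bar a_{2^m\alpha}\left(8p^{\nu(p)(k+1)-1}n+7p^{\nu(p)(k+1)}\right)\equiv 0\pmod{2^{m+4}},$$ $$\bar a_{2\beta+1}\left(8p^{\nu(p)(k+1)-1}n+7p^{\nu(p)(k+1)}\right)\equiv 0\pmod{128}.$$ (2) If $\kappa(p)\equiv 1\pmod 2$, then for all integers $n,k\ge 0$ with $p\nmid(8n+7)$, $$\bar a_{2^m\alpha}\left(8p^{6k+2}n+7p^{6k+2}\right)\equiv 0\pmod{2^{m+4}},$$ $$\bar a_{2\beta+1}\left(8p^{6k+2}n+7p^{6k+2}\right)\equiv 0\pmod{128}.$$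
   Context: For integers $\ell\ge1$ write $f_\ell=\prod_{j\ge 1}(1-q^{\ell j})$. For a positive integer $s$, $\bar a_s(n)$ denotes the number of partitions of $n$ in which each odd part occurs in one of $s$ colors and the first occurrence of each part (parts of the same size but different colors being distinct) may be overlined. Equivalently, $$\sum_{n\ge0}\bar a_s(n)q^n=\frac{f_2^{3s-2}}{f_1^{2s}f_4^{s-1}}.$$ $\left(\frac{\cdot}{p}\right)_L$ is the Legendre symbol modulo the odd prime $p$ (equal to $0$ on multiples of $p$). *)

(* Defs.v *)
From mathcomp Require Import all_boot all_order all_algebra.

Set Implicit Arguments.
Unset Strict Implicit.
Unset Printing Implicit Defensive.

Import GRing.Theory.

(* A partition of n into colored parts with overlines is encoded by a finite
   function f: the index (i, c) stands for the parts of size i.+1 and color c,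
   (f (i, c)).1 is the number of times this part occurs, and (f (i, c)).2 tells
   whether its first occurrence is overlined.  Sizes and multiplicities never
   exceed n.  Odd parts come in s colors; even parts are uncolored, which is
   rendered by allowing only the color 0 for them (so s should be positive). *)
Definition colored_overpartition (s n : nat)
    (f : {ffun 'I_n * 'I_s -> 'I_n.+1 * bool}) : bool :=
  [&& \sum_(x : 'I_n * 'I_s) x.1.+1 * (f x).1 == n,
      [forall x : 'I_n * 'I_s,
         ~~ odd x.1.+1 && (0 < x.2) ==> ((f x).1 == 0 :> nat)]
    & [forall x : 'I_n * 'I_s, (f x).2 ==> (0 < (f x).1)]].

Definition abar (s n : nat) : nat :=
  #|[set f : {ffun 'I_n * 'I_s -> 'I_n.+1 * bool}
       | colored_overpartition f]|.

Local Open Scope ring_scope.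

(* Formal power series in q over the integers, as coefficient sequences. *)
Definition fps := nat -> int.

Definition fps_one : fps := fun n => (n == 0)%N%:R.

Definition fps_mul (a b : fps) : fps :=
  fun n => \sum_(i < n.+1) a i * b (n - i)%N.

Definition fps_exp (a : fps) (k : nat) : fps := iter k (fps_mul a) fps_one.

(* f_l = prod_(j >= 1) (1 - q^(l j)) for l >= 1; the factors with j > n do not
   affect the coefficient of q^n. *)
Definition eulerf (l : nat) : fps :=
  fun n => (\prod_(1 <= j < n.+1) (1 - 'X^(l * j)) : {poly int})`_n.

Definition c4 : fps := fps_mul (eulerf 1) (fps_exp (eulerf 2) 10).

Definition legendre (a : int) (p : nat) : int :=
  if (p %| a)%Z then 0
  else if [exists x : 'I_p, (x%:Z ^+ 2 == a %[mod p])%Z] then 1 else -1.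

(* Both quotients are exact when p is odd. *)
Definition kappa (p : nat) : int :=
  c4 ((7 * (p ^ 2 - 1)) %/ 8)%N
  + p%:Z ^+ 4 * legendre (- ((7 * (p ^ 2 - 1)) %/ 4)%N%:Z) p.

Definition nu (p : nat) : nat :=
  if (kappa p == 0 %[mod 2])%Z then 4%N else 6%N.

(* Main.v *)
(* Let O = prod_(j odd) (1 + q^j)/(1 - q^j), D = prod_j (1 + q^j)/(1 - q^j),
   phi = sum_(n in Z) q^(n^2), u = sum_(x > 0 odd) q^(x^2), and write f_k for f(q^k).
   The generating function of abar_s is O^s D_2.  Gauss' identity phi(-q) D = 1 gives
   O - O(-q) = 4 u D_2 and O + O(-q) = 2 phi_4 D_2; as O(-q) = 1/O, the odd part of O^s
   is a Lucas polynomial in these two series.  Separating exponents modulo 8 shows, for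
   N = 7 mod 8 and R = u u_2 u_4, that abar_s(N) = 64 s R(N) mod 128 for s odd and
   abar_s(N) = 2^(m+3) alpha R(N) mod 2^(m+4) for s = 2^m alpha.  With S = sum_(n odd)
   sigma(n) q^n one has q dO/dq = 2 S O, and differentiating O - O(-q) yields
   sigma(N) = 8 R(N) mod 16, while R(8n+7) = c_4(n) mod 2 because
   u = q psi_8 with psi = f_2^2 / f_1.  It remains to see that 16 divides
   sigma(p^(4k+3) M) when p does not divide M, and that sigma(7 p^2) forces kappa(p)
   to be even. *)
Require Import Defs.
From HB Require Import structures.
From mathcomp Require Import all_boot all_order all_algebra.
From mathcomp Require Import boolp.
From mathcomp Require Import ring zify.

Set Implicit Arguments.
Unset Strict Implicit.
Unset Printing Implicit Defensive.

Import Order.TTheory GRing.Theory Num.Theory.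

Local Open Scope ring_scope.

(** * Power series over the integers *)

(** The guaranteed power, 2^(m+3) or 64, falls short of the claimed one by a single factor 2, so
    what remains is that R(N) is even. R counts representations and is not multiplicative; trading
    its parity for that of sigma(N) / 8 is what brings in the prime p. The argument is N = p^(4k+3)
    M with M = 8n + 7p. For k = 0, sigma(N) is (1 + p)(1 + p^2) sigma(M), and the powers of 2
    missing from the first two factors are found in sigma(M), since p M = 7 modulo 8 ties the class
    of M to that of p. The exponent then grows by 4 at a time through sigma(p^(a+4) M) = (1 + p +
    p^2 + p^3) sigma(M) + p^4 sigma(p^a M). The same trade settles kappa: the index 7(p^2-1)/8 of
    c_4 corresponds to 7 p^2, and for p other than 7 one has sigma(7 p^2) = 8(1 + p + p^2), so c_4
    is odd there, as is the Legendre term. *)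

Definition pser : Type := fps.

HB.instance Definition _ := gen_eqMixin pser.
HB.instance Definition _ := gen_choiceMixin pser.

Section PserRing.
Implicit Types f g h : pser.

Definition pser0 : pser := fun=> 0.
Definition pserN f : pser := fun n => - f n.
Definition pserD f g : pser := fun n => f n + g n.
Definition pser1 : pser := fps_one.
Definition pserM f g : pser := fps_mul f g.

Lemma pserDA : associative pserD.
Proof. by move=> f g h; apply/funext => n; rewrite /pserD addrA. Qed.
Lemma pserDC : commutative pserD.
Proof. by move=> f g; apply/funext => n; rewrite /pserD addrC. Qed.
Lemma pser0D : left_id pser0 pserD.
Proof. by move=> f; apply/funext => n; rewrite /pserD add0r. Qed.
Lemma pserND : left_inverse pser0 pserN pserD.
Proof. by move=> f; apply/funext => n; rewrite /pserD addNr. Qed.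

HB.instance Definition _ := GRing.isZmodule.Build pser pserDA pserDC pser0D pserND.

Definition trunc (N : nat) f : {poly int} := \poly_(i < N) f i.

(** Products of truncations are products of polynomials, so commutativity and associativity are
    inherited from [{poly int}] one coefficient at a time. *)
Lemma pserME f g n (N : nat) : (n < N)%N -> pserM f g n = (trunc N f * trunc N g)`_n.
Proof.
move=> nN; rewrite coefM; apply: eq_bigr => i _; rewrite !coef_poly.
have iN : (i < N)%N by apply: leq_trans nN; rewrite ltn_ord.
by rewrite iN (leq_ltn_trans (leq_subr _ _) nN).
Qed.

Lemma pserMC : commutative pserM.
Proof. by move=> f g; apply/funext => n; rewrite !(@pserME _ _ n n.+1) // mulrC. Qed.

Lemma pserMA : associative pserM.
Proof.
move=> f g h; apply/funext => n.
have E (a b c : pser) : pserM a (pserM b c) n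
   = (trunc n.+1 a * (trunc n.+1 b * trunc n.+1 c))`_n.
  rewrite coefM; apply: eq_bigr => i _; rewrite coef_poly ltn_ord.
  by rewrite -pserME // ltnS leq_subr.
rewrite [pserM (pserM f g) h]pserMC !E; by congr (nth 0 (polyseq _) n); ring.
Qed.

Lemma pser1M : left_id pser1 pserM.
Proof.
move=> f; apply/funext => n; rewrite /pserM /fps_mul big_ord_recl subn0 mul1r.
by rewrite big1 ?addr0 // => i _; rewrite mul0r.
Qed.

Lemma pserMDl : left_distributive pserM pserD.
Proof.
move=> f g h; apply/funext => n; rewrite /pserD -big_split /=.
by apply: eq_bigr => i _; rewrite mulrDl.
Qed.

Lemma pser1_neq0 : pser1 != pser0 :> pser.
Proof. by apply/eqP => /(congr1 (fun f : pser => f 0%N)). Qed.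

HB.instance Definition _ := GRing.Zmodule_isComNzRing.Build pser
  pserMA pserMC pser1M pserMDl pser1_neq0.

End PserRing.

Section Coefficients.
Implicit Types f g h : pser.

Lemma coef0s n : (0 : pser) n = 0. Proof. by []. Qed.
Lemma coef1s n : (1 : pser) n = (n == 0)%N%:R. Proof. by []. Qed.
Lemma coefDs f g n : (f + g) n = f n + g n. Proof. by []. Qed.
Lemma coefNs f n : (- f) n = - f n. Proof. by []. Qed.
Lemma coefBs f g n : (f - g) n = f n - g n. Proof. by []. Qed.
Lemma coefMs f g n : (f * g) n = \sum_(i < n.+1) f i * g (n - i)%N.
Proof. by []. Qed.
Lemma coefMns f k n : (f *+ k) n = f n *+ k.
Proof. by elim: k => // k IH; rewrite !mulrS coefDs IH. Qed.
Lemma coef_sums I r (P : pred I) (F : I -> pser) n :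
  (\sum_(i <- r | P i) F i) n = \sum_(i <- r | P i) F i n.
Proof. by elim/big_rec2: _ => // i x y _ <-. Qed.
Lemma coefM0s f g : (f * g) 0%N = f 0%N * g 0%N.
Proof. by rewrite coefMs big_ord1. Qed.

Lemma fps_expE f k : fps_exp f k = f ^+ k.
Proof. by elim: k => //= k IH; rewrite exprS -IH. Qed.

Definition qX (k : nat) : pser := fun n => (n == k)%:R.

Lemma coef_qXM k f n : (qX k * f) n = if (k <= n)%N then f (n - k)%N else 0.
Proof.
rewrite coefMs; case: leqP => [kn|nk].
  rewrite (bigD1 (Ordinal (kn : (k < n.+1)%N))) //= /qX eqxx mul1r big1 ?addr0 //.
  move=> i; rewrite -val_eqE /= => /negPf ->; exact: mul0r.
rewrite big1 // => i _; rewrite /qX (_ : (_ == _) = false) ?mul0r //.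
by apply/negbTE; have := ltn_ord i; lia.
Qed.

Lemma qX0 : qX 0 = 1. Proof. by []. Qed.

Lemma qXD j k : qX (j + k) = qX j * qX k.
Proof.
apply/funext => n; rewrite coef_qXM /qX; case: leqP => H; [congr (GRing.natmul 1 (nat_of_bool _))|rewrite (_ : (_ == _) = false) //]; lia.
Qed.

(* Congruence modulo q^(n+1). *)
Definition eqm n f g := forall i, (i <= n)%N -> f i = g i.

Lemma eqmP f g : (forall n, eqm n f g) -> f = g.
Proof. by move=> H; apply/funext => n; exact: (H n). Qed.

Lemma eqm_refl n f : eqm n f f. Proof. by []. Qed.
Lemma eqm_sym n f g : eqm n f g -> eqm n g f.
Proof. by move=> H i Hi; rewrite H. Qed.
Lemma eqm_trans n f g h : eqm n f g -> eqm n g h -> eqm n f h.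
Proof. by move=> H1 H2 i Hi; rewrite H1 ?H2. Qed.
Lemma eqm_le m n f g : (m <= n)%N -> eqm n f g -> eqm m f g.
Proof. by move=> mn H i Hi; rewrite H // (leq_trans Hi). Qed.

Lemma eqmM n f g f' g' : eqm n f f' -> eqm n g g' -> eqm n (f * g) (f' * g').
Proof.
move=> Hf Hg i Hi; rewrite !coefMs; apply: eq_bigr => j _.
have := ltn_ord j => Hj; rewrite Hf ?Hg //; lia.
Qed.

Lemma eqmD n f g f' g' : eqm n f f' -> eqm n g g' -> eqm n (f + g) (f' + g').
Proof. by move=> Hf Hg i Hi; rewrite !coefDs Hf ?Hg. Qed.

Lemma eqmX n f g k : eqm n f g -> eqm n (f ^+ k) (g ^+ k).
Proof. by move=> H; elim: k => // k IH; rewrite !exprS; apply: eqmM. Qed.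

Lemma eqm_prod n I r (P : pred I) (F G : I -> pser) :
  (forall i, P i -> eqm n (F i) (G i)) ->
  eqm n (\prod_(i <- r | P i) F i) (\prod_(i <- r | P i) G i).
Proof.
move=> H; elim/big_rec2: _ => // i x y Pi Hxy; apply: eqmM => //; exact: H.
Qed.

Lemma eqm_qXM k n f : (n < k)%N -> eqm n (qX k * f) 0.
Proof. by move=> nk i Hi; rewrite coef_qXM ifF //; lia. Qed.

(** A series with constant term 1 is not a zero divisor, by induction on the coefficients. This is
    how denominators are cleared below. *)
Lemma mulIs h f g : h 0%N = 1 -> f * h = g * h -> f = g.
Proof.
move=> h0 /eqP; rewrite -subr_eq0 -mulrBl => /eqP E; apply/eqP; rewrite -subr_eq0.
apply/eqP; apply: eqmP; move: (f - g) E => {f g} d E.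
elim=> [|n IH] i Hi.
  have := congr1 (fun f : pser => f 0%N) E; rewrite coefM0s h0 mulr1 coef0s.
  by move: Hi; rewrite leqn0 => /eqP ->.
have [Hin|Hin] := leqP i n; first exact: IH.
have -> : i = n.+1 by lia.
have := congr1 (fun f : pser => f n.+1) E; rewrite coefMs big_ord_recr /= subnn h0 mulr1.
by rewrite big1 ?add0r // => j _; rewrite IH ?mul0r // -ltnS.
Qed.

Lemma mulrn_injs k f g : (0 < k)%N -> f *+ k = g *+ k -> f = g.
Proof.
move=> k0 E; apply/funext => n; have := congr1 (fun f : pser => f n) E.
by rewrite !coefMns; apply: pmulrnI.
Qed.

(** * The substitutions of -q and of q^(k+1) for q *)

Definition negs f : pser := fun n => (-1) ^+ n * f n.

Lemma negs_additive : additive negs.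
Proof. by move=> f g; apply/funext => n; rewrite /negs !coefBs mulrBr. Qed.

Lemma negs_multiplicative : monoid_morphism negs.
Proof.
split; first by apply/funext => -[|n]; rewrite /negs !coef1s ?mulr0.
move=> f g; apply/funext => n; rewrite /negs !coefMs big_distrr /=.
apply: eq_bigr => i _; have Hi : (i <= n)%N by rewrite -ltnS.
have -> : (-1) ^+ n = (-1) ^+ i * (-1) ^+ (n - i) :> int by rewrite -exprD subnKC.
ring.
Qed.

HB.instance Definition _ := GRing.isZmodMorphism.Build pser pser negs negs_additive.
HB.instance Definition _ := GRing.isMonoidMorphism.Build pser pser negs negs_multiplicative.

(* f(q^(k+1)): the exponent is shifted so that every k gives a ring morphism. *)
Definition dil (k : nat) f : pser :=
  fun n => if (k.+1 %| n)%N then f (n %/ k.+1)%N else 0.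

Lemma dil_additive k : additive (dil k).
Proof.
by move=> f g; apply/funext => n; rewrite !coefBs /dil; case: ifP; rewrite ?coefBs ?subr0.
Qed.

(** Reindexing by i = (k+1) j. It serves the multiplicativity of [dil], and later the divisors of
    p^(a+1) M that are multiples of p. *)
Lemma sum_multiples (k m : nat) (F : nat -> int) :
  \sum_(i < (m * k.+1).+1) (if (k.+1 %| i)%N then F (i %/ k.+1)%N else 0)
  = \sum_(i < m.+1) F i.
Proof.
elim: m => [|m IH]; first by rewrite !big_ord1 dvdn0 div0n.
rewrite [RHS]big_ord_recr -IH.
rewrite -!(big_mkord xpredT (fun i => if (k.+1 %| i)%N then F (i %/ k.+1)%N else 0)).
rewrite (@big_cat_nat _ _ _ (m * k.+1).+1) //=; last by lia.
congr (_ + _); rewrite big_nat_recr /=; last by lia.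
rewrite dvdn_mull // mulnK // big_nat big1 ?add0r // => i /andP[H1 H2].
rewrite ifF //; apply/negbTE/negP => /dvdnP[j E]; move: H1 H2; rewrite {}E.
by rewrite !ltn_mul2r /=; lia.
Qed.

Lemma dil_multiplicative k : monoid_morphism (dil k).
Proof.
split.
  apply/funext => n; rewrite /dil !coef1s; case: ifP => [/dvdnP[m ->]|].
    by rewrite mulnK // muln_eq0 orbF.
  by case: n.
move=> f g; apply/funext => n; rewrite /dil !coefMs; case: ifP => [/dvdnP[m ->]|kn].
  rewrite mulnK // -(sum_multiples k m (fun i => f i * g (m - i)%N)).
  apply: eq_bigr => i _; case: ifP => [/dvdnP[j ->]|]; last by rewrite mul0r.
  by rewrite -mulnBl dvdn_mull // !mulnK.
rewrite big1 // => i _; case: ifP => ki; last by rewrite mul0r.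
rewrite ifF ?mulr0 //; apply/negbTE/negP => H; move: kn; rewrite -(@subnKC i n); last first.
  by rewrite -ltnS.
by rewrite dvdn_add.
Qed.

HB.instance Definition _ k := GRing.isZmodMorphism.Build pser pser (dil k) (@dil_additive k).
HB.instance Definition _ k := GRing.isMonoidMorphism.Build pser pser (dil k) (@dil_multiplicative k).

Lemma dil0 k f : dil k f 0%N = f 0%N.
Proof. by rewrite /dil dvdn0 div0n. Qed.

Lemma dilE k f n : dil k f (n * k.+1)%N = f n.
Proof. by rewrite /dil dvdn_mull // mulnK. Qed.

Lemma dil_dil j k f : dil j (dil k f) = dil (j.+1 * k.+1).-1 f.
Proof.
apply/funext => n; rewrite /dil prednK //.
case: ifP => [/dvdnP[m ->]|H].
  by rewrite mulnK // [(m * _)%N]mulnC dvdn_pmul2l // divnMl.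
by rewrite ifF //; apply: contraFF H; apply: dvdn_trans; rewrite dvdn_mulr.
Qed.

Lemma dil_qX k j : dil k (qX j) = qX (j * k.+1).
Proof.
apply/funext => n; rewrite /dil /qX; case: ifP => [/dvdnP[m ->]|H].
  by rewrite mulnK // eqn_mul2r.
rewrite (_ : (_ == _) = false) //; apply: contraFF H => /eqP ->; exact: dvdn_mull.
Qed.

Lemma negs_dil1 f : negs (dil 1 f) = dil 1 f.
Proof.
apply/funext => n; rewrite /negs /dil; case: ifP => [|_]; last by rewrite mulr0.
by rewrite dvdn2 -signr_odd => /negPf ->; rewrite mul1r.
Qed.

Lemma eqm_dil n k f g : eqm n f g -> eqm n (dil k f) (dil k g).
Proof.
move=> H i Hi; rewrite /dil; case: ifP => // _; apply: H.
exact: leq_trans (leq_div _ _) Hi.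
Qed.

(** This is q d/dq, which keeps every exponent in place and hence respects residue classes of
    exponents. *)
Definition qderiv f : pser := fun n => f n *+ n.

Lemma qderivD f g : qderiv (f + g) = qderiv f + qderiv g.
Proof. by apply/funext => n; rewrite /qderiv !coefDs mulrnDl. Qed.

Lemma qderivN f : qderiv (- f) = - qderiv f.
Proof. by apply/funext => n; rewrite /qderiv !coefNs mulNrn. Qed.

Lemma qderivMn f k : qderiv (f *+ k) = qderiv f *+ k.
Proof. by apply/funext => n; rewrite /qderiv !coefMns mulrnAC. Qed.

Lemma qderivM f g : qderiv (f * g) = qderiv f * g + f * qderiv g.
Proof.
apply/funext => n; rewrite /qderiv coefDs !coefMs -sumrMnl -big_split /=.
apply: eq_bigr => i _; have Hi : (i <= n)%N by rewrite -ltnS.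
by rewrite mulrnAl mulrnAr -mulrnDr subnKC.
Qed.

Lemma qderiv1 : qderiv 1 = 0.
Proof. by apply/funext => -[|n] //; rewrite /qderiv coef1s mul0rn. Qed.

Lemma qderiv_dil k f : qderiv (dil k f) = dil k (qderiv f) *+ k.+1.
Proof.
apply/funext => n; rewrite coefMns /qderiv /dil; case: ifP => [/dvdnP[m ->]|_].
  by rewrite mulnK // mulrnA.
by rewrite !mul0rn.
Qed.

Lemma qderiv_negs f : qderiv (negs f) = negs (qderiv f).
Proof. by apply/funext => n; rewrite /qderiv /negs mulrnAr. Qed.

(** All exponents lie in the class of a modulo m. Classes add under multiplication, which is what
    discards terms in the dissections. *)
Definition graded (m a : nat) f := forall n, n != a %[mod m] -> f n = 0.

Lemma gradedD m a f g : graded m a f -> graded m a g -> graded m a (f + g).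
Proof. by move=> Hf Hg n Hn; rewrite coefDs Hf ?Hg. Qed.

Lemma gradedMn m a f k : graded m a f -> graded m a (f *+ k).
Proof. by move=> Hf n Hn; rewrite coefMns Hf ?mul0rn. Qed.

Lemma gradedM m a b f g : graded m a f -> graded m b g -> graded m (a + b) (f * g).
Proof.
move=> Hf Hg n Hn; rewrite coefMs big1 // => i _; have Hi : (i <= n)%N by rewrite -ltnS.
have [Ei|Ei] := boolP (i == a %[mod m]); last by rewrite Hf ?mul0r.
rewrite Hg ?mulr0 //; apply: contra Hn => /eqP E.
by rewrite -(subnKC Hi) -modnDm (eqP Ei) E modnDm.
Qed.

Lemma graded1 m : graded m 0 1.
Proof. by move=> [|n]; rewrite ?eqxx. Qed.

Lemma gradedX m f k : graded m 0 f -> graded m 0 (f ^+ k).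
Proof.
move=> H; elim: k => [|k IH]; first exact: graded1.
by rewrite exprS; apply: (gradedM (b := 0%N) H IH).
Qed.

Lemma graded_dil m a k f : graded m a f -> graded (m * k.+1) (a * k.+1) (dil k f).
Proof.
move=> H n Hn; rewrite /dil; case: ifP => // /dvdnP[j E]; apply: H.
by apply: contra Hn => /eqP Ha; rewrite E mulnK // in Ha *; rewrite -!muln_modl Ha.
Qed.

Lemma graded_dil0 k f : graded k.+1 0 (dil k f).
Proof. by move=> n; rewrite mod0n => /negPf H; rewrite /dil /dvdn H. Qed.

Lemma graded_dvd d m a f : (d %| m)%N -> graded m a f -> graded d a f.
Proof.
move=> dm H n Hn; apply: H; apply: contra Hn => /eqP E.
by rewrite -(modn_dvdm n dm) E modn_dvdm.
Qed.

End Coefficients.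

(** * Infinite products *)

Section InfiniteProducts.
Implicit Types (F G : nat -> pser).

Definition iprod F : pser := fun n => (\prod_(1 <= j < n.+1) F j) n.

(** That is, F j = 1 modulo q^j. Factors beyond n then leave the coefficient of q^n alone, so
    [iprod], which stops at j = n, is the infinite product. *)
Definition unip F := forall j, (0 < j)%N -> eqm j.-1 (F j) 1.

Lemma iprodE F n M : unip F -> (n <= M)%N -> eqm n (iprod F) (\prod_(1 <= j < M.+1) F j).
Proof.
move=> uF nM i Hi; rewrite /iprod; have {Hi} : (i <= M)%N by lia.
elim: M {nM} => [|M IH] HiM; first by have -> : i = 0%N by lia.
have [Hi|Hi] := leqP i M; last by have -> : i = M.+1 by lia.
rewrite IH // [RHS](_ : _ = ((\prod_(1 <= j < M.+1) F j) * F M.+1) i); last first.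
  by rewrite [in LHS]big_nat_recr.
by rewrite (eqmM (@eqm_refl M _) (uF M.+1 isT)) ?mulr1.
Qed.

Lemma unipM F G : unip F -> unip G -> unip (fun j => F j * G j).
Proof. by move=> uF uG j j0; have := eqmM (uF j j0) (uG j j0); rewrite mulr1. Qed.

Lemma iprodM F G : unip F -> unip G -> iprod (fun j => F j * G j) = iprod F * iprod G.
Proof.
move=> uF uG; apply: eqmP => n; apply: eqm_trans (iprodE (unipM uF uG) (leqnn n)) _.
by rewrite big_split /=; apply: eqm_sym; apply: eqmM; apply: iprodE.
Qed.

Lemma iprod1 : iprod (fun=> 1) = 1.
Proof. by apply/funext => n; rewrite /iprod big1. Qed.

Lemma eq_iprod1 F G : (forall j, (0 < j)%N -> F j = G j) -> iprod F = iprod G.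
Proof.
by move=> H; apply/funext => n; rewrite /iprod; congr (_ n);
   apply: eq_big_nat => j /andP[j0 _]; apply: H.
Qed.

Lemma iprod0 F : iprod F 0%N = 1.
Proof. by rewrite /iprod big_geq. Qed.

Lemma iprod_negs F : negs (iprod F) = iprod (fun j => negs (F j)).
Proof. by apply/funext => n; rewrite {2}/iprod -rmorph_prod. Qed.

Lemma iprod_dil F k : unip F -> dil k (iprod F) = iprod (fun j => dil k (F j)).
Proof.
move=> uF; apply: eqmP => n i Hi.
have := @eqm_dil n k _ _ (iprodE uF (leqnn n)).
move=> /(_ i Hi) ->; rewrite rmorph_prod; symmetry; apply: (iprodE _ (leqnn n)) => //.
by move=> j j0; have := eqm_dil k (uF j j0); rewrite rmorph1.
Qed.

Lemma iprod_pairs F : unip F -> iprod F = iprod (fun j => F j.*2.-1 * F j.*2).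
Proof.
move=> uF; apply: eqmP => n.
have uF2 : unip (fun j => F j.*2.-1 * F j.*2).
  move=> j j0; have -> : 1 = 1 * 1 :> pser by rewrite mulr1.
  by apply: eqmM; [apply: (eqm_le _ (uF j.*2.-1 _))|apply: (eqm_le _ (uF j.*2 _))]; lia.
apply: eqm_trans (iprodE uF (_ : (n <= n.*2)%N)) _; first by lia.
apply: eqm_trans _ (eqm_sym (iprodE uF2 (leqnn n))).
suff E m : \prod_(1 <= j < m.*2.+1) F j = \prod_(1 <= j < m.+1) (F j.*2.-1 * F j.*2) by rewrite E.
elim: m => [|m IH]; first by rewrite !big_geq.
rewrite doubleS (@big_nat_recr _ _ _ m.*2.+2) // (@big_nat_recr _ _ _ m.*2.+1) // [RHS]big_nat_recr //=.
by rewrite -IH doubleS -mulrA.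
Qed.

(** The logarithmic derivative of the product is the sum [LL] of those of the factors; since [L j]
    vanishes below q^j, each coefficient of [LL] is a finite sum. *)
Lemma qderiv_iprod F (L : nat -> pser) (LL : pser) :
    unip F -> (forall j, (0 < j)%N -> qderiv (F j) = F j * L j) ->
    (forall j, (0 < j)%N -> eqm j.-1 (L j) 0) ->
    (forall n, LL n = \sum_(1 <= j < n.+1) L j n) ->
  qderiv (iprod F) = iprod F * LL.
Proof.
move=> uF HL L0 HLL; apply: eqmP => n.
have HLn : eqm n (\sum_(1 <= j < n.+1) L j) LL.
  move=> i Hi; rewrite HLL coef_sums [LHS](@big_cat_nat _ _ _ i.+1) //=.
  rewrite [X in _ + X](_ : _ = 0) ?addr0 // big_nat big1 // => j /andP[H _].
  apply: L0; lia.
apply: eqm_trans _ (eqmM (eqm_sym (iprodE uF (leqnn n))) HLn).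
move=> i Hi; rewrite /qderiv (iprodE uF (leqnn n) Hi) -[LHS]/(qderiv (\prod_(1 <= j < n.+1) F j) i).
congr (_ i); elim: (n) => [|m IH]; first by rewrite !big_geq // qderiv1 mulr0.
rewrite !(@big_nat_recr _ _ _ m.+1) //= qderivM IH HL //.
by rewrite mulrDr mulrA mulrAC.
Qed.

End InfiniteProducts.

(** * The factors (1 + q^j)/(1 - q^j) and their logarithmic derivatives *)

Definition geo (j : nat) : pser := fun n => (j %| n)%N%:R.

Lemma geoE j : (0 < j)%N -> (1 - qX j) * geo j = 1.
Proof.
move=> j0; apply/funext => n; rewrite mulrBl mul1r coefBs coef_qXM /geo coef1s.
case: leqP => [jn|nj]; first by rewrite dvdn_subl // subrr (_ : (n == 0)%N = false) //; lia.
rewrite subr0; case: (posnP n) => [->|n0]; first by rewrite dvdn0.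
by rewrite gtnNdvd // (_ : (n == 0)%N = false) //; lia.
Qed.

Definition Efac (j : nat) : pser := (1 + qX j) * geo j.

Lemma EfacE j : (0 < j)%N -> (1 - qX j) * Efac j = 1 + qX j.
Proof. by move=> j0; rewrite /Efac mulrCA geoE // mulr1. Qed.

Lemma coef_1subqX j : (0 < j)%N -> (1 - qX j) 0%N = 1.
Proof. by move=> j0; rewrite coefBs /qX coef1s (_ : (0 == j)%N = false) ?subr0 //; lia. Qed.

Lemma eqm_1subqX n j : (n < j)%N -> eqm n (1 - qX j) 1.
Proof.
move=> nj i Hi; rewrite coefBs /qX (_ : (i == j) = false) ?subr0 //; lia.
Qed.

Lemma eqm_1addqX n j : (n < j)%N -> eqm n (1 + qX j) 1.
Proof.
move=> nj i Hi; rewrite coefDs /qX (_ : (i == j) = false) ?addr0 //; lia.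
Qed.

Lemma eqm_geo n j : (n < j)%N -> eqm n (geo j) 1.
Proof.
move=> nj; have j0 : (0 < j)%N by lia.
apply: eqm_sym; rewrite -[X in eqm n _ X]mul1r -{1}(geoE j0).
by apply: eqmM => //; apply: eqm_1subqX.
Qed.

Lemma eqm_Efac n j : (n < j)%N -> eqm n (Efac j) 1.
Proof.
move=> nj; rewrite -[X in eqm n _ X]mul1r.
by apply: eqmM; [apply: eqm_1addqX|apply: eqm_geo].
Qed.

Lemma unip_Efac : unip Efac.
Proof. by move=> j j0; apply: eqm_Efac; lia. Qed.

Lemma dil_geo k j : (0 < j)%N -> dil k (geo j) = geo (j * k.+1).
Proof.
move=> j0; have jk : (0 < j * k.+1)%N by rewrite muln_gt0 j0.
apply: (mulIs (coef_1subqX jk)); rewrite mulrC [RHS]mulrC geoE // -dil_qX.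
by rewrite -{1}(rmorph1 (dil k)) -rmorphB -rmorphM geoE // rmorph1.
Qed.

Lemma dil_Efac k j : (0 < j)%N -> dil k (Efac j) = Efac (j * k.+1).
Proof. by move=> j0; rewrite /Efac rmorphM rmorphD rmorph1 /= dil_qX dil_geo. Qed.

Lemma negs_qX_odd j : odd j -> negs (qX j) = - qX j.
Proof.
move=> oj; apply/funext => n; rewrite /negs coefNs /qX; case: eqP => [->|_]; last by rewrite mulr0 oppr0.
by rewrite -signr_odd oj mulr1.
Qed.

Lemma Efac_negs j : odd j -> Efac j * negs (Efac j) = 1.
Proof.
move=> oj; have j0 : (0 < j)%N by case: j oj.
have E : (1 + qX j) * negs (Efac j) = 1 - qX j.
  have := congr1 negs (EfacE j0).
  by rewrite rmorphM rmorphB rmorphD rmorph1 /= negs_qX_odd // opprK.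
apply: (mulIs (coef_1subqX j0)); rewrite mulrAC [_ * (1 - _)]mulrC EfacE // E mul1r //.
Qed.

Lemma qderiv_qX j : qderiv (qX j) = qX j *+ j.
Proof.
by apply/funext => n; rewrite coefMns /qderiv /qX; case: eqP => [->|_] //; rewrite !mul0rn.
Qed.

(** The logarithmic derivative of (1 + q^j)/(1 - q^j) under q d/dq: j q^j/(1 + q^j) + j q^j/(1 -
    q^j) = 2j q^j/(1 - q^(2j)). *)
Definition Llog (j : nat) : pser := (qX j * geo j.*2) *+ j.*2.

Lemma qderiv_Efac j : (0 < j)%N -> qderiv (Efac j) = Efac j * Llog j.
Proof.
move=> j0; have H := geoE j0.
have H2 : geo j = (1 + qX j) * geo j.*2.
  have j20 : (0 < j.*2)%N by lia.
  apply: (mulIs (coef_1subqX j0)); rewrite mulrC H -[LHS](geoE j20) -addnn qXD.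
  by ring.
have HT : qderiv (geo j) = geo j * geo j * qX j *+ j.
  apply: (mulIs (coef_1subqX j0)).
  have := congr1 qderiv H; rewrite qderivM qderivD qderivN qderiv1 qderiv_qX sub0r.
  rewrite mulNr => /eqP; rewrite addrC subr_eq0 mulrC => /eqP ->.
  rewrite -(mulr_natl (qX j)) -(mulr_natl (_ * _ * qX j)).
  have -> : j%:R * (geo j * geo j * qX j) * (1 - qX j)
     = j%:R * qX j * geo j * ((1 - qX j) * geo j) by ring.
  by rewrite H mulr1 mulrC.
rewrite /Efac qderivM qderivD qderiv1 add0r HT qderiv_qX /Llog -addnn mulrnDr.
rewrite -(mulr_natl (qX j)) -(mulr_natl (_ * _ * qX j)) -(mulr_natl (qX j * _)) addnn.
move: H H2; set g := geo j; set x := qX j; set h := geo _; move: (j%:R) => J H H2.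
have E : g = 1 + x * g by rewrite -[X in _ = X + _]H; ring.
transitivity (2 * J * x * g * ((1 + x) * h)); last by ring.
transitivity (J * x * g * (1 + x * g) + J * x * g * g); first by ring.
by rewrite -E -H2; ring.
Qed.

Definition sigma (n : nat) : nat := (\sum_(1 <= d < n.+1 | d %| n) d)%N.

Definition Sser : pser := fun n => if odd n then (sigma n)%:Z else 0.

(* The generating function of abar_s is Oser ^+ s * Dser(q^2). *)
Definition Oser : pser := iprod (fun j => if odd j then Efac j else 1).
Definition Dser : pser := iprod Efac.

Lemma unip_if (b : pred nat) F : unip F -> unip (fun j => if b j then F j else 1).
Proof. by move=> uF j j0; case: ifP => // _; apply: uF. Qed.

Lemma dil_D : dil 1 Dser = iprod (fun j => if odd j then 1 else Efac j).
Proof.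
rewrite [RHS]iprod_pairs; last first.
  by move=> j j0; case: ifP => // _; apply: unip_Efac.
rewrite /Dser iprod_dil; last exact: unip_Efac.
apply: eq_iprod1 => j j0; rewrite odd_double ifT ?mul1r; last by lia.
by rewrite dil_Efac // muln2.
Qed.

Lemma D_O : Dser = Oser * dil 1 Dser.
Proof.
rewrite dil_D -iprodM; first by apply: eq_iprod1 => j _; case: ifP; rewrite ?mulr1 ?mul1r.
  exact: unip_if unip_Efac.
by move=> j j0; case: ifP => // _; apply: unip_Efac.
Qed.

Lemma O_negs : Oser * negs Oser = 1.
Proof.
rewrite /Oser iprod_negs -iprodM.
- rewrite (@eq_iprod1 _ (fun=> 1)) ?iprod1 // => j _.
  by case: ifP => [|_]; [apply: Efac_negs|rewrite rmorph1 mulr1].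
- exact: unip_if unip_Efac.
move=> j j0; case: ifP => _; last by rewrite rmorph1.
move=> i Hi; rewrite /negs (unip_Efac j0) // coef1s.
by case: i {Hi} => [|i]; rewrite ?mulr0.
Qed.

Lemma qderiv_O : qderiv Oser = Oser * Sser *+ 2.
Proof.
rewrite -mulrnAr; apply: (@qderiv_iprod _ (fun j => if odd j then Llog j else 0)).
- exact: unip_if unip_Efac.
- by move=> j j0; case: ifP => _; [apply: qderiv_Efac|rewrite qderiv1 mulr0].
- move=> j j0 i Hi; case: ifP => // _; rewrite /Llog coefMns.
  by rewrite (@eqm_qXM j j.-1) ?mul0rn //; lia.
move=> n; rewrite coefMns /Sser /sigma.
have E j : (0 < j)%N -> (if odd j then Llog j else 0) n =
   if odd n && (j %| n)%N then (j *+ 2)%:Z else 0.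
  move=> j0; case: ifP => oj; last first.
    rewrite ifF //; apply/negbTE/negP => /andP[on /dvdnP[k Ek]].
    by move: on; rewrite Ek oddM oj andbF.
  rewrite /Llog coefMns coef_qXM /geo.
  have [jn|nj] := leqP j n; last first.
    rewrite mul0rn ifF //; apply/negbTE/negP => /andP[on /dvdn_leq]; move: on.
    by case: (n) nj => // m; lia.
  (* The exponents of q^j/(1 - q^(2j)) are the odd multiples of j; as j is odd, these are the odd n
     divisible by j. *)
  have -> : (j.*2 %| n - j)%N = (odd n && (j %| n))%N.
    apply/idP/idP => [/dvdnP[k Ek]|/andP[on /dvdnP[k Ek]]].
      have -> : n = (k.*2.+1 * j)%N by lia.
      by rewrite oddM oj /= odd_double dvdn_mull.
    move: on; rewrite Ek oddM oj andbT => ok.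
    have -> : (k * j - j = k./2 * j.*2)%N by have := odd_double_half k; rewrite ok; nia.
    exact: dvdn_mull.
  by case: ifP; rewrite ?mul0rn // -muln2 -mulr_natl; lia.
rewrite (eq_big_nat _ _ (F2 := fun j => if odd n && (j %| n)%N then (j *+ 2)%:Z else 0)); last first.
  by move=> j /andP[j0 _]; apply: E.
case: ifP => on; last by rewrite big1 ?mul0rn.
rewrite -big_mkcond /= (big_morph Posz PoszD (erefl _)) -sumrMnl.
by apply: eq_bigr => j _; lia.
Qed.

(** * The identities of Gauss *)

Definition issq (n : nat) : bool := [exists k : 'I_n.+1, (k * k == n)%N].

Lemma issqP n : reflect (exists k, n = k * k)%N (issq n).
Proof.
apply: (iffP existsP) => [[k /eqP <-]|[k ->]]; first by exists k.
have kk : (k < (k * k).+1)%N by nia.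
by exists (Ordinal kk).
Qed.

Definition phi : pser := fun n => if n == 0%N then 1 else if issq n then 2 else 0.

Definition Dpart (n : nat) : pser := \prod_(1 <= j < n.+1) Efac j.

Lemma DpartS n : Dpart n.+1 = Dpart n * Efac n.+1.
Proof. by rewrite /Dpart big_nat_recr. Qed.

Lemma Dpart_cross n : (1 - qX n.+1) * Dpart n.+1 = (1 + qX n.+1) * Dpart n.
Proof. by rewrite DpartS mulrCA EfacE // mulrC. Qed.

Definition phipart (n : nat) : pser := 1 + \sum_(s < n) (-1) ^+ s.+1 * qX (s.+1 * s.+1) *+ 2.

(* Shanks' finite form of Gauss' identity phi(-q) * prod_j (1+q^j)/(1-q^j) = 1. *)
Lemma shanks_phi n : phipart n * Dpart n
  = 1 + \sum_(s < n) (-1) ^+ s.+1 * (Dpart s + Dpart s.+1) * qX (s.+1 * n.+1).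
Proof.
elim: n => [|n IH].
  by rewrite /phipart !big_ord0 addr0 mul1r /Dpart big_geq.
have x0 := @coef_1subqX n.+1 isT.
apply: (mulIs x0); rewrite [LHS]mulrC [RHS]mulrC mulrCA Dpart_cross.
have -> : phipart n.+1 = phipart n + (-1) ^+ n.+1 * qX (n.+1 * n.+1) *+ 2.
  by rewrite /phipart big_ord_recr /= addrA.
transitivity ((1 + qX n.+1) * (phipart n * Dpart n)
   + (1 + qX n.+1) * ((-1) ^+ n.+1 * qX (n.+1 * n.+1) * Dpart n *+ 2)); first by ring.
rewrite {}IH [in RHS]big_ord_recr /=.
(* The right-hand sums at n+1 and n, multiplied by 1 - q^(n+1) and 1 + q^(n+1), differ by a sum that
   telescopes. Its partial sums have this closed form, used at k = n. *)
have T k : \sum_(s < k) (-1) ^+ s.+1 * (Dpart s + Dpart s.+1) *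
      ((1 - qX n.+1) * qX (s.+1 * n.+2) - (1 + qX n.+1) * qX (s.+1 * n.+1))
    = (qX n.+1 - (-1) ^+ k * (qX (k.+1 * n.+1) * Dpart k)) *+ 2.
  elim: k => [|k IHk].
    by rewrite big_ord0 expr0 mul1n /Dpart big_geq // mulr1 mul1r subrr mul0rn.
  rewrite big_ord_recr /= IHk.
  have := Dpart_cross k; set d := Dpart k; set d' := Dpart k.+1; move: d d' => d d' Hd.
  have -> : qX (k.+1 * n.+2) = qX (k.+1 * n.+1) * qX k.+1.
    by rewrite -qXD; congr qX; lia.
  have -> : qX (k.+2 * n.+1) = qX (k.+1 * n.+1) * qX n.+1.
    by rewrite -qXD; congr qX; lia.
  have -> : (-1) ^+ k.+1 = - (-1) ^+ k :> pser by rewrite exprS mulN1r.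
  move: Hd; move: (qX (k.+1 * n.+1)) (qX n.+1) (qX k.+1) ((-1) ^+ k : pser) => X x y e Hd.
  transitivity (x *+ 2 - e * X * d *+ 2 + e * X *
     ((d + (1 - y) * d' - y * d) + x * (d + y * d + d' + y * d'))); first by ring.
  rewrite Hd.
  transitivity (x *+ 2 + e * X * x * (d + y * d + d' + y * d')); first by ring.
  rewrite (_ : d + y * d + d' + y * d' = (1 + y) * d + d' + y * d'); last by ring.
  by rewrite -Hd; ring.
have := T n; rewrite (eq_bigr (fun s : 'I_n =>
    (1 - qX n.+1) * ((-1) ^+ s.+1 * (Dpart s + Dpart s.+1) * qX (s.+1 * n.+2))
    - (1 + qX n.+1) * ((-1) ^+ s.+1 * (Dpart s + Dpart s.+1) * qX (s.+1 * n.+1))));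
  last by move=> s _; ring.
rewrite sumrB -!big_distrr /=.
set S1 : pser := \sum_(_ < _) _; set S2 : pser := \sum_(_ < _) _.
have := Dpart_cross n; set d := Dpart n; set d' := Dpart n.+1; move: d d' => d d' Hd.
have -> : qX (n.+1 * n.+2) = qX (n.+1 * n.+1) * qX n.+1.
  by rewrite -qXD; congr qX; lia.
have -> : (-1) ^+ n.+1 = - (-1) ^+ n :> pser by rewrite exprS mulN1r.
move: Hd S1 S2; move: (qX (n.+1 * n.+1)) (qX n.+1) ((-1) ^+ n : pser) => X x e Hd S1 S2 HT.
transitivity (1 + x + (1 - x) * S1 - ((1 - x) * S1 - (1 + x) * S2)
   - (1 + x) * (e * X * d *+ 2)); first by ring.
rewrite HT.
transitivity (1 - x + (1 - x) * S1 - (e * X * x * d *+ 2)); first by ring.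
rewrite [RHS](_ : _ = 1 - x + (1 - x) * S1 - e * X * x * ((1 - x) * d + (1 - x) * d')); last by ring.
by rewrite Hd; ring.
Qed.

Lemma coef_signM k (f : pser) n : ((-1) ^+ k * f) n = (-1) ^+ k * f n.
Proof.
elim: k => [|k IH]; first by rewrite !expr0 !mul1r.
by rewrite !exprS !mulN1r !mulNr coefNs IH.
Qed.

(** In Shanks' identity all exponents (s+1)(n+1) on the right exceed n, so only 1 is left modulo
    q^(n+1). *)
Lemma gauss_phi : negs phi * Dser = 1.
Proof.
apply: eqmP => n.
have Hphi : eqm n (negs phi) (phipart n).
  move=> i Hi; rewrite /negs /phipart coefDs coef_sums /phi coef1s.
  have Eq s : ((-1) ^+ s.+1 * qX (s.+1 * s.+1) *+ 2 : pser) i =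
     (-1) ^+ s.+1 * (i == s.+1 * s.+1)%N%:R *+ 2.
    by rewrite coefMns coef_signM.
  under eq_bigr do rewrite Eq.
  case: (posnP i) => [->|i0]; first by rewrite big1 ?mulr1 // => s _; rewrite mulr0 mul0rn.
  rewrite add0r.
  case: issqP => [[k Ek]|Hn]; last first.
    rewrite mulr0 big1 // => s _; case: eqP => [E|_]; last by rewrite mulr0 mul0rn.
    by case: Hn; exists s.+1.
  have kn : (k.-1 < n)%N by nia.
  rewrite (bigD1 (Ordinal kn)) //= prednK; last by lia.
  rewrite -Ek eqxx big1 ?addr0 => [|s Hs].
    by rewrite -signr_odd Ek oddM andbb signr_odd mulr1 mulr_natr.
  case: eqP => [E|_]; last by rewrite mulr0 mul0rn.
  by case/eqP: Hs; apply: val_inj => /=; nia.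
apply: eqm_trans (eqmM Hphi (iprodE unip_Efac (leqnn n))) _.
rewrite -[X in eqm _ (_ * X)]/(Dpart n) shanks_phi -[X in eqm _ _ X]addr0.
apply: eqmD => // i Hi; rewrite coef_sums big1 // => s _.
by rewrite mulrC (@eqm_qXM (s.+1 * n.+1)%N n) //; nia.
Qed.

Definition uodd : pser := fun n => (odd n && issq n)%:R.
(** 8n + 1 is a square exactly when n is triangular, so this is the series of the triangular
    numbers, in a form suited to odd squares. *)
Definition psi : pser := fun n => (issq n.*2.*2.*2.+1)%:R.

Lemma phi_split : phi = dil 3 phi + uodd *+ 2.
Proof.
apply/funext => n; rewrite coefDs coefMns /phi /uodd /dil.
have [on|en] := boolP (odd n).
  have -> : (4 %| n)%N = false.
    by apply/negbTE/negP => /dvdnP[k E]; move: on; rewrite E oddM andbF.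
  by rewrite add0r; case: (n) on => //= m _; case: issq.
rewrite mul0rn addr0.
have [->|n0] := eqVneq n 0%N; first by rewrite dvdn0 div0n.
case: ifP => [/issqP[k Ek]|Hs].
  have ek : ~~ odd k by move: en; rewrite Ek oddM andbb.
  have Ek2 : (n = k./2 * k./2 * 4)%N.
    by rewrite Ek -[in LHS](odd_double_half k) (negPf ek); lia.
  rewrite Ek2 dvdn_mull // mulnK // ifF; last by apply/negbTE; nia.
  by rewrite (introT (issqP _)) //; exists k./2.
case: ifP => // /dvdnP[m Em]; rewrite Em mulnK // ifF; last by apply/negbTE; lia.
case: issqP => // -[k Ek]; move: Hs; rewrite (introT (issqP _)) //.
by exists (k * 2)%N; rewrite Em Ek; lia.
Qed.

Lemma uodd_graded : graded 8 1 uodd.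
Proof.
move=> n Hn; rewrite /uodd; case: andP => // -[on /issqP[k Ek]]; case/negP: Hn.
have ok : odd k by move: on; rewrite Ek oddM andbb.
rewrite Ek -[k]odd_double_half ok.
have [j [] ->] : exists j, (k./2 = j.*2 \/ k./2 = j.*2.+1).
  by exists (k./2)./2; have := odd_double_half k./2; case: odd => /= <-; rewrite ?uphalf_double ?doubleK; lia.
  by apply/eqP; apply: (eqP (_ : _ == _ %[mod 8])); rewrite eqn_mod_dvd; last lia; apply/dvdnP;
    exists (j * (j.*2 + 1))%N; lia.
by apply/eqP; apply: (eqP (_ : _ == _ %[mod 8])); rewrite eqn_mod_dvd; last lia; apply/dvdnP;
    exists ((j.+1) * (j.*2 + 1))%N; lia.
Qed.

Lemma uodd_psi : uodd = qX 1 * dil 7 psi.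
Proof.
apply/funext => n; rewrite coef_qXM /dil /psi.
have [H|H] := boolP (n == 1 %[mod 8]); last first.
  rewrite (uodd_graded H); case: leqP => // n1; rewrite ifF //.
  by apply: contraNF H; rewrite eqn_mod_dvd.
have n1 : (0 < n)%N by case: (n) H.
rewrite n1 -eqn_mod_dvd // H /uodd.
have E : (n = ((n - 1) %/ 8).*2.*2.*2.+1)%N.
  by move: H; rewrite eqn_mod_dvd // => /divnK; lia.
by rewrite -E {1}E /= odd_double.
Qed.

(** The factors of 1/psi, from Gauss' product of (1 - q^(2j))/(1 - q^(2j-1)) for psi. *)
Definition Bfac (j : nat) : pser := (1 - qX j.*2.-1) * geo j.*2.
Definition Bser : pser := iprod Bfac.
Definition Bpart (n : nat) : pser := \prod_(1 <= j < n.+1) Bfac j.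

Lemma unip_Bfac : unip Bfac.
Proof.
move=> j j0; rewrite -[X in eqm _ _ X]mul1r.
by apply: eqmM; [apply: eqm_1subqX|apply: eqm_geo]; lia.
Qed.

Lemma Bpart_cross n : (1 - qX n.*2.+2) * Bpart n.+1 = (1 - qX n.*2.+1) * Bpart n.
Proof.
rewrite /Bpart big_nat_recr //= /Bfac doubleS /=.
set b := \prod_(_ <= _ < _) _; have := @geoE n.*2.+2 isT.
move: (geo _) (qX n.*2.+2) (qX n.*2.+1) b => g y z b H.
transitivity ((1 - y) * g * ((1 - z) * b)); first by ring.
by rewrite H mul1r.
Qed.

(** Finite form of Gauss' product for psi: modulo q^(2n+1) only the term s = 0 survives on the
    right, and it is 1. The induction telescopes as for [shanks_phi]. *)
Lemma shanks_psi n : Bpart n * \sum_(t < n.*2) qX ((t * t.+1) %/ 2)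
  = \sum_(s < n) Bpart s * qX (s * n.*2.+1).
Proof.
elim: n => [|n IH]; first by rewrite !big_ord0 mulr0.
have y0 := @coef_1subqX n.*2.+2 isT.
apply: (mulIs y0); rewrite [LHS]mulrC [RHS]mulrC mulrA Bpart_cross.
rewrite doubleS 2![in LHS]big_ord_recr /=.
have -> : ((n.*2 * n.*2.+1) %/ 2 = n * n.*2.+1)%N by rewrite -muln2 mulnAC mulnK.
have -> : ((n.*2.+1 * n.*2.+2) %/ 2 = n * n.*2.+1 + n.*2.+1)%N.
  by rewrite (_ : _ * _ = (n * n.*2.+1 + n.*2.+1) * 2)%N ?mulnK //; lia.
rewrite qXD mulrDr mulrDr -mulrA mulrC.
rewrite -/(Bpart n).
transitivity ((1 - qX n.*2.+1) * (Bpart n * \sum_(t < n.*2) qX ((t * t.+1) %/ 2)) +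
  (1 - qX n.*2.+1) * (1 + qX n.*2.+1) * Bpart n * qX (n * n.*2.+1)); first by ring.
rewrite {}IH [in RHS]big_ord_recr /=.
have T k : \sum_(s < k) (Bpart s * ((1 - qX n.*2.+2) * qX (s * n.*2.+3) - (1 - qX n.*2.+1) * qX (s * n.*2.+1)))
   = qX (k * n.*2.+1) * Bpart k * (1 - qX k.*2).
  elim: k => [|k IHk]; first by rewrite big_ord0 qX0 subrr mulr0.
  rewrite big_ord_recr /= {}IHk.
  have := Bpart_cross k; set b := Bpart k; set b' := Bpart k.+1; move: b b' => b b' Hb.
  have -> : qX (k.+1 * n.*2.+1) = qX (k * n.*2.+1) * qX n.*2.+1.
    by rewrite -qXD; congr qX; lia.
  have -> : qX (k * n.*2.+3) = qX (k * n.*2.+1) * qX k.*2.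
    by rewrite -qXD; congr qX; lia.
  rewrite doubleS -[RHS]mulrA [b' * _]mulrC Hb.
  have -> : qX n.*2.+2 = qX n.*2.+1 * qX 1 by rewrite -qXD; congr qX; lia.
  have -> : qX k.*2.+1 = qX k.*2 * qX 1 by rewrite -qXD; congr qX; lia.
  ring.
have := T n; rewrite (eq_bigr (fun s : 'I_n =>
    (1 - qX n.*2.+2) * (Bpart s * qX (s * n.*2.+3))
    - (1 - qX n.*2.+1) * (Bpart s * qX (s * n.*2.+1)))); last by move=> s _; ring.
rewrite sumrB -!big_distrr /=.
set S1 : pser := \sum_(_ < _) _; set S2 : pser := \sum_(_ < _) _.
have -> : qX (n * n.*2.+3) = qX (n * n.*2.+1) * qX n.*2.
  by rewrite -qXD; congr qX; lia.
move: (Bpart n) S1 S2 => b S1 S2 /eqP; rewrite subr_eq => /eqP HT.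
rewrite [RHS]mulrDr HT.
have E : qX n.*2.+2 * qX n.*2 = qX n.*2.+1 * qX n.*2.+1.
  by rewrite -!qXD; congr qX; lia.
transitivity ((1 - qX n.*2.+1) * S2 + b * qX (n * n.*2.+1) * (1 - qX n.*2.+1 * qX n.*2.+1)); first by ring.
by rewrite -E; ring.
Qed.

Lemma psi_B : psi * Bser = 1.
Proof.
apply: eqmP => n.
have Hpsi : eqm n psi (\sum_(t < n.+1.*2) qX ((t * t.+1) %/ 2)).
  move=> i Hi; rewrite coef_sums /psi /qX; case: issqP => [[k Ek]|Hn]; last first.
    rewrite big1 // => t _; case: eqP => // E; case: Hn; exists t.*2.+1.
    have : (2 %| t * t.+1)%N by rewrite dvdn2 oddM /= andbN.
    by move/divnK; rewrite -E; lia.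
  have ok : odd k by have := congr1 odd Ek; rewrite oddM andbb /= odd_double.
  have Ek2 : (k = k./2.*2.+1)%N by rewrite -[LHS]odd_double_half ok.
  have kn : (k./2 < n.+1.*2)%N by nia.
  have Ei : (i = (k./2 * k./2.+1) %/ 2)%N.
    by rewrite (_ : k./2 * k./2.+1 = i * 2)%N ?mulnK //; nia.
  rewrite (bigD1 (Ordinal kn)) //= -Ei eqxx big1 ?addr0 // => t Ht.
  case: eqP => // E; case/eqP: Ht; apply: val_inj => /=.
  have : (2 %| t * t.+1)%N by rewrite dvdn2 oddM /= andbN.
  by move/divnK; rewrite -E; nia.
apply: eqm_trans (eqmM Hpsi (iprodE unip_Bfac (leqnSn n))) _.
rewrite -/(Bpart n.+1) mulrC shanks_psi big_ord_recl mul0n qX0 mulr1.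
rewrite /Bpart big_geq // -[X in eqm _ _ X]addr0.
apply: eqmD => // i Hi; rewrite coef_sums big1 // => s _.
by rewrite mulrC (@eqm_qXM _ n) //= /bump /=; nia.
Qed.

Definition fser : pser := iprod (fun j => 1 - qX j).

Lemma unip_1subqX : unip (fun j => 1 - qX j).
Proof. by move=> j j0; apply: eqm_1subqX; lia. Qed.

(** Taken in pairs, the factors of f_1 are (1 - q^(2j))^2 times those of [Bser]; hence f_1 = f_2^2
    [Bser], where [Bser] inverts psi. *)
Lemma psi_f : psi * fser = dil 1 fser ^+ 2.
Proof.
have E : fser = dil 1 fser * dil 1 fser * Bser.
  have u2 : unip (fun j => 1 - qX j.*2) by move=> j j0; apply: eqm_1subqX; lia.
  have -> : dil 1 fser = iprod (fun j => 1 - qX j.*2).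
    rewrite /fser iprod_dil; last exact: unip_1subqX.
    by apply: eq_iprod1 => j _; rewrite rmorphB rmorph1 /= dil_qX muln2.
  rewrite -!iprodM //; [|exact: unipM|exact: unip_Bfac].
  rewrite /fser iprod_pairs; last exact: unip_1subqX.
  apply: eq_iprod1 => j j0; rewrite /Bfac; have j20 : (0 < j.*2)%N by lia.
  have := geoE j20; move: (geo _) (qX j.*2) (qX j.*2.-1) => g x y H.
  transitivity ((1 - x) * g * ((1 - x) * (1 - y))); last by ring.
  by rewrite H; ring.
by rewrite [in LHS]E mulrCA psi_B mulr1 expr2.
Qed.

(** The Frobenius congruence modulo 2. With f = c + q g the difference is (c^2 - c) + 2 c q g + q^2
    (g^2 - g(q^2)), and the last term refers to coefficient n - 2 for g, whence the induction on n
    with f varying. *)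
Lemma sqr_dil (f : pser) : exists g : pser, f ^+ 2 = dil 1 f + g *+ 2.
Proof.
suff H n : forall f : pser, (2 %| (f ^+ 2 - dil 1 f) n)%Z.
  have H1 n : exists z : int, (f ^+ 2 - dil 1 f) n = z *+ 2.
    by have /dvdzP[z ->] := H n f; exists z; rewrite mulr_natr.
  exists (fun n => sval (cid (H1 n))); apply/funext => n.
  by rewrite coefDs coefMns -(svalP (cid (H1 n))) coefBs addrC subrK.
elim/ltn_ind: n => n IH {}f.
pose c : pser := fun k => if k == 0%N then f 0%N else 0.
pose g : pser := fun k => f k.+1.
have Ef : f = c + qX 1 * g.
  apply/funext => k; rewrite coefDs coef_qXM /g /c.
  by case: k => [|k] /=; rewrite ?addr0 ?add0r ?subn1.
have Ec (h : pser) k : (c * h) k = f 0%N * h k.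
  rewrite coefMs big_ord_recl /= subn0 big1 ?addr0.
    by [].
  by move=> i _; rewrite /c mul0r.
have Ed : dil 1 f = c + qX 2 * dil 1 g.
  rewrite {1}Ef rmorphD rmorphM /= dil_qX; congr (_ + _).
  apply/funext => k; rewrite /dil /c.
  case: ifP => [/dvdnP[m ->]|]; first by rewrite mulnK // muln_eq0 orbF.
  by case: k.
have -> : f ^+ 2 - dil 1 f = (c * c - c) + c * (qX 1 * g) *+ 2 + qX 2 * (g ^+ 2 - dil 1 g).
  by rewrite Ed {1}Ef (qXD 1 1); ring.
rewrite coefDs coef_qXM rpredD //; last first.
  by case: ltnP => [n2|_]; [apply: IH; lia|apply: dvdz0].
rewrite coefDs coefMns rpredD //; last by rewrite -[_ *+ 2]mulr_natr; apply: dvdz_mull.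
rewrite coefBs Ec /c.
case: eqP => _; last by rewrite mulr0 subr0 dvdz0.
apply/dvdzP; move: (f 0%N) => z; have [k [->|->]] : exists k, z = k * 2 \/ z = k * 2 + 1.
- exists (z %/ 2)%Z; lia.
- exists (k * (k * 2 - 1)); ring.
exists (k * (k * 2 + 1)); ring.
Qed.

(** * Generating functions *)

Definition eqmod (k : nat) (f g : pser) := exists h : pser, f = g + h *+ k.

Lemma eqmod_refl k f : eqmod k f f.
Proof. by exists 0; rewrite mul0rn addr0. Qed.

Lemma eqmod_trans k f g h : eqmod k f g -> eqmod k g h -> eqmod k f h.
Proof. by move=> [a ->] [b ->]; exists (b + a); rewrite mulrnDl addrA. Qed.

Lemma eqmod_sym k f g : eqmod k f g -> eqmod k g f.
Proof. by move=> [a ->]; exists (- a); rewrite mulNrn addrK. Qed.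

Lemma eqmodM k f g f' g' : eqmod k f f' -> eqmod k g g' -> eqmod k (f * g) (f' * g').
Proof.
move=> [a ->] [b ->]; exists (f' * b + a * g' + a * b *+ k).
by ring.
Qed.

Lemma eqmodX k f g n : eqmod k f g -> eqmod k (f ^+ n) (g ^+ n).
Proof.
move=> H; elim: n => [|n IH]; first exact: eqmod_refl.
by rewrite !exprS; apply: eqmodM.
Qed.

Lemma eqmod_dil k j f g : eqmod k f g -> eqmod k (dil j f) (dil j g).
Proof. by move=> [a ->]; exists (dil j a); rewrite rmorphD rmorphMn. Qed.

Lemma eqmod_coef k f g n : eqmod k f g -> (k%:Z %| f n - g n)%Z.
Proof.
move=> [a ->]; rewrite coefDs coefMns addrC addKr -mulr_natr natz.
exact: dvdz_mull.
Qed.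

Definition Rser : pser := uodd * dil 1 uodd * dil 3 uodd.

Lemma eulerf_iprod (l : nat) : eulerf l = iprod (fun j => 1 - qX (l * j)).
Proof.
apply/funext => n; rewrite /eulerf /iprod.
have emb (p q : {poly int}) k : (p * q)`_k = fps_mul (fun i => p`_i) (fun i => q`_i) k.
  by rewrite coefM.
suff H m k : (\prod_(1 <= j < m.+1) (1 - 'X^(l * j)) : {poly int})`_k
   = (\prod_(1 <= j < m.+1) (1 - qX (l * j))) k by exact: H.
elim: m k => [|m IH] k; first by rewrite !big_geq // coef1.
rewrite !(@big_nat_recr _ _ _ m.+1) //= emb; congr (fps_mul _ _ k); apply/funext => i.
  exact: IH.
by rewrite coefB coef1 coefXn.
Qed.

Lemma c4E : c4 = fser * dil 1 fser ^+ 10.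
Proof.
rewrite /c4 fps_expE !eulerf_iprod.
have -> : iprod (fun j => 1 - qX (1 * j)) = fser by apply: eq_iprod1 => j _; rewrite mul1n.
have -> // : dil 1 fser = iprod (fun j => 1 - qX (2 * j)).
rewrite /fser iprod_dil; last exact: unip_1subqX.
by apply: eq_iprod1 => j _; rewrite rmorphB rmorph1 /= dil_qX mulnC.
Qed.

(** In psi = f_2^2/f_1, one factor f_2 is f_1^2 modulo 2. The series [iprod geo] is 1/f_1. *)
Lemma psi_mod2 : eqmod 2 psi (fser * dil 1 fser).
Proof.
have ug : unip geo by move=> j j0; apply: eqm_geo; lia.
have fV : fser * iprod geo = 1.
  rewrite -iprodM //; last exact: unip_1subqX.
  by transitivity (iprod (fun=> 1)); [apply: eq_iprod1 => j j0; apply: geoE|apply: iprod1].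
have [g Hg] := sqr_dil fser; have Hp := psi_f.
exists (- (g * dil 1 fser * iprod geo)).
move: Hg Hp fV; move: (dil 1 fser) (iprod geo) => f2 v Hg Hp fV.
transitivity (psi * fser * v); first by rewrite -mulrA fV mulr1.
rewrite Hp.
have -> : f2 ^+ 2 * v = (fser ^+ 2 - g *+ 2) * f2 * v by rewrite Hg; ring.
transitivity (fser * f2 * (fser * v) - g * f2 * v *+ 2); first by ring.
by rewrite fV; ring.
Qed.

(** Since u = q psi(q^8), R is q^7 times psi psi_2 psi_4 taken at q^8. Modulo 2 that product is f_1
    f_2 * f_2 f_4 * f_4 f_8, and f_4 = f_2^2, f_8 = f_2^4 turn it into f_1 f_2^10. *)
Lemma Rser_c4 n : (2 %| Rser (8 * n + 7)%N - c4 n)%Z.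
Proof.
have -> : Rser (8 * n + 7)%N = (psi * dil 1 psi * dil 3 psi) n.
  rewrite /Rser uodd_psi !rmorphM /= !dil_qX !dil_dil.
  rewrite (_ : _ * _ * _ = qX 7 * dil 7 (psi * dil 1 psi * dil 3 psi)); last first.
    rewrite !rmorphM /= !dil_dil (_ : qX 7 = qX 1 * qX (1 * 2) * qX (1 * 4)); first by ring.
    by rewrite -!qXD.
  by rewrite coef_qXM leq_addl addnK mulnC dilE.
rewrite -[2]/(2%:Z); apply: eqmod_coef; rewrite c4E.
have F f : eqmod 2 (dil 1 f) (f ^+ 2) by apply: eqmod_sym; have [g Hg] := sqr_dil f; exists g.
have F2 : eqmod 2 (dil 3 fser) (dil 1 fser ^+ 2) by rewrite -(dil_dil 1 1).
have F3 : eqmod 2 (dil 7 fser) (dil 1 fser ^+ 4).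
  rewrite -(dil_dil 1 3); apply: eqmod_trans (F _) _.
  by rewrite (exprM _ 2 2); apply: eqmodX.
have P1 := psi_mod2; have P2 := eqmod_dil 1 P1; have P3 := eqmod_dil 3 P1.
move: P2 P3; rewrite !rmorphM /= !dil_dil /= => P2 P3.
apply: eqmod_trans (eqmodM (eqmodM P1 P2) P3) _.
apply: eqmod_trans (eqmodM (eqmodM (eqmod_refl _ _) (eqmodM (eqmod_refl _ _) F2)) (eqmodM F2 F3)) _.
rewrite (_ : _ * _ = fser * dil 1 fser ^+ 10); [exact: eqmod_refl|ring].
Qed.

(** Each function f is one choice of a term in every factor of a product indexed by size and color,
    so distributivity turns the count into a product of local series. *)
Lemma abarE s n : (0 < s)%N -> (abar s n)%:Z = (Oser ^+ s * dil 1 Dser) n.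
Proof.
move=> s0.
pose ok (x : 'I_n * 'I_s) (v : 'I_n.+1 * bool) :=
  (~~ odd x.1.+1 && (0 < x.2)%N ==> (v.1 == 0 :> nat)) && (v.2 ==> (0 < v.1)%N).
pose F (x : 'I_n * 'I_s) (v : 'I_n.+1 * bool) : pser :=
  if ok x v then qX (x.1.+1 * v.1) else 0.
have FE (f : {ffun 'I_n * 'I_s -> 'I_n.+1 * bool}) : \prod_x F x (f x) = if [forall x, ok x (f x)]
    then qX (\sum_(x : 'I_n * 'I_s) x.1.+1 * (f x).1)%N else 0.
  case: ifP => [/forallP H|/negbT].
    rewrite (big_morph qX qXD qX0); apply: eq_bigr => x _; by rewrite /F H.
  rewrite negb_forall => /existsP[x Hx].
  by rewrite (bigD1 x) //= {1}/F (negPf Hx) mul0r.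
have -> : (abar s n)%:Z = (\prod_x \sum_v F x v) n.
  rewrite bigA_distr_bigA coef_sums /abar -sum1_card big_mkcond /=.
  rewrite (big_morph Posz PoszD (erefl _)); apply: eq_bigr => f _.
  rewrite FE inE /colored_overpartition.
  set c1 := [forall x : 'I_n * 'I_s, _ ==> ((f x).1 == 0 :> nat)].
  set c2 := [forall x : 'I_n * 'I_s, (f x).2 ==> _].
  have -> : [forall x, ok x (f x)] = c1 && c2.
    apply/forallP/andP => [H|[/forallP H1 /forallP H2] x]; last by rewrite /ok H1 H2.
    by split; apply/forallP => x; have /andP[] := H x.
  case: (c1 && c2); last by rewrite andbF.
  by rewrite andbT /qX eq_sym; case: eqP.
(* This holds only modulo q^(n+1), multiplicities being capped at n. A positive multiplicity counts
   twice, plain or overlined, giving 1 + 2q^i + 2q^(2i) + ... = (1 + q^i)/(1 - q^i); an even size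
   with a nonzero color has multiplicity 0. *)
have SE (x : 'I_n * 'I_s) : eqm n (\sum_v F x v)
    (if ~~ odd x.1.+1 && (0 < x.2)%N then 1 else Efac x.1.+1).
  rewrite (eq_bigr (fun p => F x (p.1, p.2))); last by case.
  rewrite -(pair_bigA _ (fun a b => F x (a, b))) /=.
  rewrite (eq_bigr (fun a : 'I_n.+1 => (if ~~ odd x.1.+1 && (0 < x.2)%N && (0 < a)%N then 0 else
      qX (x.1.+1 * a)) *+ (0 < a).+1)); last first.
    move=> a _; rewrite big_bool /F /ok /=; move: (_ && (0 < x.2)%N) => c.
    by case: c; case: (posnP a) => [->|a0] /=; rewrite ?addr0 ?add0r ?eqxx ?mulr2n
      ?gtn_eqF ?addr0.
  move=> i Hi; rewrite big_ord_recl coefDs coef_sums muln0 andbF mulr1n qX0.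
  case: ifP => Hx.
    by rewrite big1 ?addr0 // => a _; rewrite mul0rn.
  rewrite /Efac mulrDl mul1r coefDs coef_qXM /geo.
  under eq_bigr do rewrite coefMns.
  have [->|i0] := posnP i.
    by rewrite big1 ?addr0 ?dvdn0.
  have -> : (1 : pser) i = 0 by rewrite coef1s (_ : (i == 0)%N = false) //; lia.
  rewrite add0r; case: (boolP (x.1.+1 %| i)%N) => [/dvdnP[k Ek]|Hd].
    have k0 : (k.-1 < n)%N by nia.
    rewrite (bigD1 (Ordinal k0)) //= /bump /= add1n prednK; last by nia.
    have xk : (x.1 < k * x.1.+1)%N by apply: leq_pmull; nia.
    rewrite Ek mulnC /qX eqxx xk dvdn_subl ?dvdn_mull //.
    rewrite big1 ?addr0 // => a Ha; case: eqP => [/eqP E|_]; last by rewrite mul0rn.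
    move: E; rewrite mulnC eqn_mul2l /= => /eqP E.
    by case/eqP: Ha; apply: val_inj => /=; move: E; rewrite /bump /=; lia.
  rewrite big1 => [|a _]; last first.
    rewrite /qX; case: eqP => [E|_]; last by rewrite mul0rn.
    by move: Hd; rewrite E dvdn_mulr.
  by case: leqP => // xi; rewrite dvdn_subl // (negPf Hd).
have u2 : unip (fun j => if odd j then 1 else Efac j).
  by move=> j j0; case: ifP => // _; apply: unip_Efac.
have u0 : unip (fun j => if odd j then Efac j else 1) by exact: unip_if unip_Efac.
have H := eqmM (eqmX s (iprodE u0 (leqnn n))) (iprodE u2 (leqnn n)).
have H2 := @eqm_prod n _ (index_enum _) xpredT _ _ (fun x _ => SE x).
rewrite dil_D (H n (leqnn n)) (H2 n (leqnn n)).
congr (_ n); rewrite -prodrXl -big_split /= big_add1 /= big_mkord.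
rewrite -(pair_bigA _ (fun (i : 'I_n) (c : 'I_s) => if ~~ odd i.+1 && (0 < c)%N then 1 else Efac i.+1)) /=.
apply: eq_bigr => i _; case: ifP => oi /=.
  by rewrite prodr_const card_ord mulr1.
rewrite expr1n mul1r (bigD1 (Ordinal s0)) //= big1 ?mulr1 // => c Hc.
by rewrite lt0n; case: eqP => // E; case/eqP: Hc; apply: val_inj.
Qed.

(** * Odd parts of powers of O *)

Section LucasSequences.
Variables (A : comPzRingType) (a b : A).
Hypothesis ab1 : a * b = 1.

Fixpoint sumsq (k : nat) : nat := if k is k'.+1 then (sumsq k' + k * k)%N else 0%N.

(** As a b = 1, a^2 + b^2 = (a - b)^2 + 2, so powers two apart obey a recursion in (a - b)^2. The
    factor [e] covers differences (-1) and sums (1) at once. *)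
Lemma lucas_rec (e : A) k : a ^+ k.+4 + e * b ^+ k.+4 =
  ((a - b) ^+ 2 + 2) * (a ^+ k.+2 + e * b ^+ k.+2) - (a ^+ k + e * b ^+ k).
Proof.
have -> : (a - b) ^+ 2 + 2 = a ^+ 2 + b ^+ 2.
  by transitivity ((a - b) ^+ 2 + 2 * (a * b)); [rewrite ab1 mulr1|ring].
have Ha : b ^+ 2 * a ^+ k.+2 = a ^+ k.
  by rewrite !exprS expr0; transitivity ((a * b) * (a * b) * a ^+ k); [ring|rewrite ab1 !mul1r].
have Hb : a ^+ 2 * b ^+ k.+2 = b ^+ k.
  by rewrite !exprS expr0; transitivity ((a * b) * (a * b) * b ^+ k); [ring|rewrite ab1 !mul1r].
rewrite -[X in _ = _ - (X + _)]Ha -[X in _ = _ - (_ + _ * X)]Hb !exprS !expr0; ring.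
Qed.

(** Expansion of an odd-index Lucas polynomial in d = a - b: the coefficient of d is 2k+1 and that
    of d^3 is 1^2 + ... + k^2. *)
Lemma lucas_diff k : exists X, a ^+ k.*2.+1 - b ^+ k.*2.+1 =
  (a - b) *+ k.*2.+1 + (a - b) ^+ 3 *+ sumsq k + (a - b) ^+ 5 * X.
Proof.
suff [] : (exists X, a ^+ k.*2.+1 - b ^+ k.*2.+1 =
  (a - b) *+ k.*2.+1 + (a - b) ^+ 3 *+ sumsq k + (a - b) ^+ 5 * X) /\
  (exists X, a ^+ k.+1.*2.+1 - b ^+ k.+1.*2.+1 =
  (a - b) *+ k.+1.*2.+1 + (a - b) ^+ 3 *+ sumsq k.+1 + (a - b) ^+ 5 * X) by [].
elim: k => [|k [H1 [X HX]]].
  split; exists 0; first by rewrite mulr0n mulr0 !addr0.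
  rewrite (_ : 1.*2.+1 = 3)%N // (_ : sumsq 1 = 1%N) //.
  transitivity ((a - b) * ((a - b) ^+ 2 + 3 * (a * b))); first by ring.
  by rewrite ab1; ring.
split; first by exists X.
have [Y HY] := H1; exists ((a - b) ^+ 2 * X + X *+ 2 - Y + 1 *+ sumsq k.+1).
have := lucas_rec (-1) k.*2.+1; rewrite !mulN1r => ->.
rewrite -doubleS HX HY.
move: (a - b) => d; rewrite /= -!addnn; ring.
Qed.

Lemma lucas_sum k : exists Y, a ^+ k.*2.+1 + b ^+ k.*2.+1 = a + b + (a - b) ^+ 2 * Y.
Proof.
suff [] : (exists X, a ^+ k.*2.+1 + b ^+ k.*2.+1 = a + b + (a - b) ^+ 2 * X) /\
  (exists X, a ^+ k.+1.*2.+1 + b ^+ k.+1.*2.+1 = a + b + (a - b) ^+ 2 * X) by [].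
elim: k => [|k [[Y HY] [X HX]]].
  split; first by exists 0; rewrite mulr0 addr0.
  exists (a + b); rewrite (_ : 1.*2.+1 = 3)%N //.
  transitivity ((a + b) * ((a - b) ^+ 2 + a * b)); first by ring.
  by rewrite ab1; ring.
split; first by exists X.
exists ((a - b) ^+ 2 * X + X *+ 2 - Y + (a + b)).
have := lucas_rec 1 k.*2.+1; rewrite !mul1r => ->.
rewrite -doubleS HX HY; ring.
Qed.

Lemma lucas_double n : a ^+ n.*2 + b ^+ n.*2 = 2 + (a ^+ n - b ^+ n) ^+ 2.
Proof.
have H : a ^+ n * b ^+ n = 1 by rewrite -exprMn ab1 expr1n.
rewrite -addnn !exprD; transitivity (2 * (a ^+ n * b ^+ n) + (a ^+ n - b ^+ n) ^+ 2); first by ring.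
by rewrite H mulr1.
Qed.

(** The first doubling multiplies by a^(2k+1) + b^(2k+1), which is 2z modulo 16. Each later one
    multiplies by 2 + (a^n - b^n)^2 with 4 dividing a^n - b^n, that is by 2 modulo 16, so the
    bracket is preserved modulo 8. *)
Lemma lucas_even y z k m : a - b = y *+ 4 -> a + b = z *+ 2 ->
  exists X, a ^+ (2 ^ m.+1 * k.*2.+1) - b ^+ (2 ^ m.+1 * k.*2.+1)
    = (y * z *+ k.*2.+1 + X *+ 8) *+ 2 ^ (m + 3).
Proof.
move=> Hy Hz.
have dbl n : a ^+ n.*2 - b ^+ n.*2 = (a ^+ n - b ^+ n) * (a ^+ n + b ^+ n).
  by rewrite -addnn !exprD; ring.
elim: m => [|m [X IH]].
  rewrite expn1 mul2n dbl.
  have [X ->] := lucas_diff k; have [Y ->] := lucas_sum k.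
  rewrite Hz Hy add0n (_ : (2 ^ 3 = 8)%N) //.
  exists (y * (y *+ k.*2.+1 * y * Y + (y ^+ 2 *+ sumsq k *+ 2 + y ^+ 4 * X *+ 32) * (z + y ^+ 2 * Y *+ 8))).
  ring.
rewrite expnS -mulnA mul2n dbl IH.
have -> : (2 ^ m.+1 * k.*2.+1 = (2 ^ m * k.*2.+1).*2)%N by rewrite expnS -mulnA mul2n.
rewrite lucas_double subrXX Hy; set c := \sum_(_ < _) _.
rewrite (_ : 2 ^ (m.+1 + 3) = 2 ^ (m + 3) * 2)%N; last by rewrite addSn expnSr.
exists (X + (y * z *+ k.*2.+1 + X *+ 8) * (y * c) ^+ 2).
rewrite mulrnDl [in RHS]mulrnA; move: (_ ^ _)%N (k.*2.+1) => e j.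
ring.
Qed.

End LucasSequences.

Lemma negsK (f : pser) : negs (negs f) = f.
Proof. by apply/funext => n; rewrite /negs mulrA -expr2 sqrr_sign mul1r. Qed.

Lemma negs_odd (f : pser) : (forall n, ~~ odd n -> f n = 0) -> negs f = - f.
Proof.
move=> H; apply/funext => n; rewrite /negs coefNs -signr_odd.
by case: (boolP (odd n)) => [_|/H ->]; rewrite ?mulN1r // mulr0 oppr0.
Qed.

Lemma uodd_even n : ~~ odd n -> uodd n = 0.
Proof. by rewrite /uodd => /negPf ->. Qed.

Lemma negs_phi : negs phi = dil 3 phi - uodd *+ 2.
Proof.
rewrite {1}phi_split rmorphD rmorphMn /= (negs_odd uodd_even) mulNrn.
by rewrite -(dil_dil 1 1) negs_dil1.
Qed.

(** Gauss' identity at -q reads phi O(-q) D_2 = 1, and O(-q) is the inverse of O. *)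
Lemma O_phi : Oser = phi * dil 1 Dser.
Proof.
have H : phi * negs Oser * dil 1 Dser = 1.
  have := congr1 negs gauss_phi.
  by rewrite [in X in X -> _]D_O !rmorphM rmorph1 /= negsK negs_dil1 mulrA.
transitivity (Oser * (phi * negs Oser * dil 1 Dser)); first by rewrite H mulr1.
transitivity (Oser * negs Oser * (phi * dil 1 Dser)); first by ring.
by rewrite O_negs mul1r.
Qed.

Lemma negsO_phi : negs Oser = negs phi * dil 1 Dser.
Proof. by rewrite {1}O_phi rmorphM /= negs_dil1. Qed.

Lemma D_phi : Dser = phi * dil 1 Dser ^+ 2.
Proof. by rewrite {1}D_O {1}O_phi expr2 mulrA. Qed.

Lemma O_sub : Oser - negs Oser = (uodd * dil 1 Dser) *+ 4.
Proof. by rewrite {1}O_phi negsO_phi negs_phi {1}phi_split; ring. Qed.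

Lemma O_add : Oser + negs Oser = (dil 3 phi * dil 1 Dser) *+ 2.
Proof. by rewrite {1}O_phi negsO_phi negs_phi {1}phi_split; ring. Qed.

Lemma phi_mod2 : eqmod 2 phi 1.
Proof.
exists (fun n => ((0 < n)%N && issq n)%:R); apply/funext => n.
by rewrite coefDs coefMns /phi coef1s; case: n => // n; case: issq.
Qed.

Lemma eqmod_negs k f g : eqmod k f g -> eqmod k (negs f) (negs g).
Proof. by move=> [a ->]; exists (negs a); rewrite rmorphD rmorphMn. Qed.

Lemma D_mod2 : eqmod 2 Dser 1.
Proof.
have H := eqmodM (eqmod_sym (eqmod_negs phi_mod2)) (eqmod_refl 2 Dser).
by move: H; rewrite rmorph1 mul1r gauss_phi.
Qed.

Lemma eqmod1M k f g : eqmod k f 1 -> eqmod k g 1 -> eqmod k (f * g) 1.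
Proof. by move=> Hf Hg; have := eqmodM Hf Hg; rewrite mulr1. Qed.

Lemma eqmod1X k f n : eqmod k f 1 -> eqmod k (f ^+ n) 1.
Proof. by move=> H; have := eqmodX n H; rewrite expr1n. Qed.

Lemma eqmod1_dil k j f : eqmod k f 1 -> eqmod k (dil j f) 1.
Proof. by move=> H; have := eqmod_dil j H; rewrite rmorph1. Qed.

Lemma gradedM0 m f g : graded m 0 f -> graded m 0 g -> graded m 0 (f * g).
Proof. exact: gradedM. Qed.

Lemma coef_graded0 m a f n : graded m a f -> n != a %[mod m] -> f n = 0.
Proof. by move=> H; apply: H. Qed.

Lemma graded_mod m a b f : a = b %[mod m] -> graded m a f -> graded m b f.
Proof. by move=> E H n Hn; apply: H; rewrite E. Qed.

Lemma dil15_graded (f : pser) : graded 8 0 (dil 15 f).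
Proof. by have := @graded_dil0 15 f; apply: graded_dvd. Qed.

Lemma graded84 a f : graded 8 a f -> graded 4 a f.
Proof. exact: graded_dvd. Qed.

Lemma v_graded : graded 8 2 (dil 1 uodd).
Proof. have := graded_dil (k := 1) uodd_graded; exact: (@graded_dvd 8 (8 * 2) (1 * 2) (dil 1 uodd) isT). Qed.

Lemma w_graded : graded 8 4 (dil 3 uodd).
Proof. have := graded_dil (k := 3) uodd_graded; exact: (@graded_dvd 8 (8 * 4) (1 * 4) (dil 3 uodd) isT). Qed.

Lemma vv_graded : graded 4 0 ((dil 1 uodd) * (dil 1 uodd)).
Proof.
have := gradedM v_graded v_graded => /(@graded_dvd 4 8 _ _ isT).
exact: graded_mod.
Qed.

Lemma ww_graded : graded 8 0 ((dil 3 uodd) * (dil 3 uodd)).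
Proof. by have := gradedM w_graded w_graded; apply: graded_mod. Qed.

Ltac grade0 := repeat match goal with
  | |- graded _ _ (_ + _) => apply: gradedD
  | |- graded _ _ (_ *+ _) => apply: gradedMn
  | |- graded _ _ (dil 1 _ * dil 1 _) => exact: vv_graded
  | |- graded 8 _ (dil 3 _ * dil 3 _) => exact: ww_graded
  | |- graded _ _ (_ * _) => apply: gradedM0
  | |- graded _ _ (_ ^+ _) => apply: gradedX
  | |- graded 8 _ (dil 7 _) => exact: graded_dil0
  | |- graded 8 _ (dil 15 _) => exact: dil15_graded
  | |- graded 4 _ (dil 3 _) => exact: graded_dil0
  | |- graded 4 _ (dil 7 _) => apply: graded84; exact: graded_dil0
  | |- graded 4 _ (dil 15 _) => apply: graded84; exact: dil15_graded
  end.

(** * Dissection modulo 8 *)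

Section Dissections.
Local Notation u := uodd.
Local Notation v := (dil 1 uodd).
Local Notation w := (dil 3 uodd).
Local Notation V := (dil 7 phi).
Local Notation W := (dil 15 phi).
Local Notation D7 := (dil 7 Dser).

Lemma dil3_phi : dil 3 phi = W + w *+ 2.
Proof. by rewrite {1}phi_split rmorphD rmorphMn /= dil_dil. Qed.

(** Using D = phi D_2^2 at q^2 and then at q^4 leaves D only in q^8; phi_2 and phi_4 are split into
    even and odd squares. *)
Lemma D1_split : dil 1 Dser = (V + v *+ 2) * ((W + w *+ 2) * D7 ^+ 2) ^+ 2.
Proof.
have E1 : dil 1 phi = V + v *+ 2 by rewrite {1}phi_split rmorphD rmorphMn /= dil_dil.
have E3 : dil 3 Dser = dil 3 phi * D7 ^+ 2.
  by rewrite {1}D_phi rmorphM rmorphXn /= dil_dil.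
by rewrite -dil3_phi -E3 -E1 {1}D_phi rmorphM rmorphXn /= dil_dil.
Qed.

Lemma coef_peel m1 a1 m2 a2 (f g h : pser) n : graded m1 a1 f -> graded m2 a2 g ->
  n != a1 %[mod m1] -> n != a2 %[mod m2] -> (f + g + h) n = h n.
Proof. by move=> Hf Hg n1 n2; rewrite !coefDs Hf // Hg // !add0r. Qed.

(* Sorting the terms by their exponents modulo 8 leaves only u v w, the grades of u, v, w
   being 1, 2, 4. *)
Lemma uDD_coef n : n = 7 %[mod 8] ->
  (64 %| (u * dil 1 Dser ^+ 2) n - 32 * Rser n)%Z.
Proof.
move=> Hn; pose Q := W * W * (W * W) + W * W * (w * w) *+ 24 + w * w * (w * w) *+ 16.
pose q := W * W * W *+ 8 + W * (w * w) *+ 32.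
have E : u * dil 1 Dser ^+ 2 = u * ((V * V + (v * v) *+ 4) * ((Q + q * w) * D7 ^+ 8))
   + u * v * (V * Q * D7 ^+ 8) *+ 4
   + Rser * (V * (W * W * W + W * (w * w) *+ 4) * D7 ^+ 8) *+ 32.
  by rewrite D1_split /Q /q /Rser; ring.
have G1 : graded 4 1 (u * ((V * V + (v * v) *+ 4) * ((Q + q * w) * D7 ^+ 8))).
  apply: (gradedM (a := 1) (b := 0)); first exact: graded84 uodd_graded.
  by rewrite /Q /q; grade0.
have G2 : graded 8 3 (u * v * (V * Q * D7 ^+ 8) *+ 4).
  apply: gradedMn; apply: (gradedM (a := 3) (b := 0)); last by rewrite /Q; grade0.
  exact: (gradedM uodd_graded v_graded).
rewrite {}E (coef_peel _ G1 G2) ?Hn //; last by rewrite -(@modn_dvdm 8) // Hn.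
rewrite coefMns.
have [h Hh] : eqmod 2 (V * (W * W * W + W * (w * w) *+ 4) * D7 ^+ 8) 1.
  apply: eqmod1M; last by apply: eqmod1X; apply: eqmod1_dil; exact: D_mod2.
  apply: eqmod1M; first by apply: eqmod1_dil; exact: phi_mod2.
  have [x Hx] := eqmod1_dil 15 phi_mod2; rewrite Hx.
  exists (x *+ 3 + x * x *+ 6 + x * x * x *+ 4 + (1 + x *+ 2) * (w * w) *+ 2); ring.
rewrite Hh mulrDr mulr1 coefDs mulrnAr coefMns.
apply/dvdzP; exists ((Rser * h) n); rewrite -[_ *+ 2]mulr_natr -[_ *+ 32]mulr_natr; ring.
Qed.

(** The product is u (V + 2v)^3 (W + 2w)^7 D_8^12. [Q] and [C] collect what carries a factor 8;
    among the rest only u v w reaches the class 7, with coefficient 6 * 14 = 84, which is 4 modulo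
    8. *)
Lemma uUDDD_coef n : n = 7 %[mod 8] ->
  (8 %| (u * dil 3 phi * dil 1 Dser ^+ 3) n - 4 * Rser n)%Z.
Proof.
move=> Hn.
pose P0 := W ^+ 7 + W ^+ 5 * (w * w) *+ 84.
pose Q := W ^+ 4 * w ^+ 3 *+ 35 + W ^+ 3 * w ^+ 4 *+ 70 + W ^+ 2 * w ^+ 5 *+ 84
  + W * w ^+ 6 *+ 56 + w ^+ 7 *+ 16.
pose C := (V ^+ 3 + V ^+ 2 * v *+ 6 + V * (v * v) *+ 12) * Q
   + v ^+ 3 * (P0 + W ^+ 6 * w *+ 14 + Q *+ 8).
have [B E] : exists B, u * dil 3 phi * dil 1 Dser ^+ 3 =
   u * ((V ^+ 3 + V * (v * v) *+ 12) * (P0 + W ^+ 6 * w *+ 14) * D7 ^+ 12)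
   + u * v * (V ^+ 2 * P0 * D7 ^+ 12) *+ 6
   + (Rser * (V ^+ 2 * W ^+ 6 * D7 ^+ 12) *+ 84 + B *+ 8).
  exists (u * C * D7 ^+ 12); by rewrite D1_split dil3_phi /C /Q /P0 /Rser; ring.
have G1 : graded 4 1 (u * ((V ^+ 3 + V * (v * v) *+ 12) * (P0 + W ^+ 6 * w *+ 14) * D7 ^+ 12)).
  apply: (gradedM (a := 1) (b := 0)); first exact: graded84 uodd_graded.
  by rewrite /P0; grade0.
have G2 : graded 8 3 (u * v * (V ^+ 2 * P0 * D7 ^+ 12) *+ 6).
  apply: gradedMn; apply: (gradedM (a := 3) (b := 0)); last by rewrite /P0; grade0.
  exact: (gradedM uodd_graded v_graded).
rewrite {}E (coef_peel _ G1 G2) ?Hn //; last by rewrite -(@modn_dvdm 8) // Hn.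
rewrite coefDs !coefMns.
have [h Hh] : eqmod 2 (V ^+ 2 * W ^+ 6 * D7 ^+ 12) 1.
  apply: eqmod1M; last by apply: eqmod1X; apply: eqmod1_dil; exact: D_mod2.
  by apply: eqmod1M; apply: eqmod1X; apply: eqmod1_dil; exact: phi_mod2.
rewrite Hh mulrDr mulr1 coefDs mulrnAr coefMns.
apply/dvdzP; exists (Rser n * 10 + (Rser * h) n * 21 + B n).
rewrite -[_ *+ 2]mulr_natr -[_ *+ 84]mulr_natr -[_ *+ 8]mulr_natr; ring.
Qed.

End Dissections.

Lemma coef_odd_part s n : odd n ->
  (Oser ^+ s * dil 1 Dser) n *+ 2 = ((Oser ^+ s - negs Oser ^+ s) * dil 1 Dser) n.
Proof.
move=> on; rewrite mulrBl coefBs.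
have -> : negs Oser ^+ s * dil 1 Dser = negs (Oser ^+ s * dil 1 Dser).
  by rewrite rmorphM rmorphXn /= negs_dil1.
by rewrite /negs -signr_odd on mulN1r opprK mulr2n.
Qed.

(** D_2 is 1 modulo 2, so D_2^4 is 1 modulo 4, and u^3 has exponents 3 modulo 8. This removes the
    cubic Lucas term, which carries only a factor 32, modulo 128. *)
Lemma uuu_coef n : n = 7 %[mod 8] -> (4 %| (uodd ^+ 3 * dil 1 Dser ^+ 4) n)%Z.
Proof.
move=> Hn; have [h ->] := eqmod1_dil 1 D_mod2.
have [B ->] : exists B, uodd ^+ 3 * (1 + h *+ 2) ^+ 4 = uodd * uodd * uodd + B *+ 4.
  by exists (uodd ^+ 3 * (h *+ 2 + h ^+ 2 *+ 6 + h ^+ 3 *+ 8 + h ^+ 4 *+ 4)); ring.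
have G : graded 8 3 (uodd * uodd * uodd).
  exact: (gradedM (gradedM uodd_graded uodd_graded) uodd_graded).
by rewrite coefDs (coef_graded0 G) ?Hn // add0r coefMns -[_ *+ 4]mulr_natr dvdz_mull.
Qed.

(** With a - b = 4 u D_2, halving the Lucas expansion leaves factors 2, 32 and 512 on the terms of
    degree 1, 3 and at least 5; [uDD_coef] modulo 64 settles the first. *)
Lemma abar_odd k n : n = 7 %[mod 8] ->
  (128 %| (abar k.*2.+1 n)%:Z - 64 * k.*2.+1%:Z * Rser n)%Z.
Proof.
move=> Hn; have on : odd n by rewrite -(@odd_mod n 8) // Hn.
rewrite abarE //; have := coef_odd_part k.*2.+1 on.
have [X ->] := lucas_diff O_negs k; rewrite O_sub.
have := uDD_coef Hn; have := uuu_coef Hn; set Y := dil 1 Dser.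
have [B ->] : exists B, ((uodd * Y) *+ 4 *+ k.*2.+1 + ((uodd * Y) *+ 4) ^+ 3 *+ sumsq k
    + ((uodd * Y) *+ 4) ^+ 5 * X) * Y
  = ((uodd * Y ^+ 2) *+ k.*2.+1 *+ 2 + ((uodd ^+ 3 * Y ^+ 4) *+ sumsq k *+ 32 + B *+ 512)) *+ 2.
  by exists (uodd ^+ 5 * Y ^+ 6 * X); ring.
move: (uodd * Y ^+ 2) (uodd ^+ 3 * Y ^+ 4) (_ * Y) => p q G.
rewrite coefMns => /dvdzP[y Hy] /dvdzP[x Hx] /(@pmulrnI _ 2 isT) ->.
rewrite coefDs [X in _ + X - _]coefDs !coefMns Hy.
have -> : p n = x * 64 + 32 * Rser n by rewrite -Hx subrK.
apply/dvdzP; exists (x * k.*2.+1%:Z + y * (sumsq k)%:Z + B n * 4).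
rewrite -[_ *+ 2]mulr_natr -[_ *+ 32]mulr_natr -[_ *+ 512]mulr_natr.
rewrite -[_ *+ k.*2.+1]mulr_natr -[_ *+ sumsq k]mulr_natr !natz; ring.
Qed.

(** Taking y = u D_2 and z = phi_4 D_2 in [lucas_even] and halving leaves 2^(m+2) times (2k+1) u
    phi_4 D_2^3 modulo 8. *)
Lemma abar_even m k n : n = 7 %[mod 8] ->
  ((2 ^ (m.+1 + 4))%:Z %| (abar (2 ^ m.+1 * k.*2.+1) n)%:Z
     - (2 ^ (m.+1 + 3))%:Z * k.*2.+1%:Z * Rser n)%Z.
Proof.
move=> Hn; have on : odd n by rewrite -(@odd_mod n 8) // Hn.
rewrite abarE; last by rewrite muln_gt0 expn_gt0.
have := coef_odd_part (2 ^ m.+1 * k.*2.+1) on.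
have [X ->] := lucas_even O_negs k m O_sub O_add.
have := uUDDD_coef Hn.
set Y := dil 1 Dser; rewrite (_ : 2 ^ (m + 3) = 2 ^ m.+2 * 2)%N; last by rewrite addn3 expnSr.
have -> e : (uodd * Y * (dil 3 phi * Y) *+ k.*2.+1 + X *+ 8) *+ (e * 2) * Y
  = ((uodd * dil 3 phi * Y ^+ 3) *+ k.*2.+1 + (X * Y) *+ 8) *+ e *+ 2 by ring.
move: (uodd * _ * Y ^+ 3) (X * Y) (_ * Y) => p B G.
rewrite coefMns => /dvdzP[x Hx] /(@pmulrnI _ 2 isT) ->.
rewrite coefMns coefDs !coefMns.
have -> : p n = x * 8 + 4 * Rser n by rewrite -Hx subrK.
rewrite addn4 addn3 (expnS 2 m.+4) (expnS 2 m.+3) (expnS 2 m.+2); move: (2 ^ m.+2)%N => e.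
apply/dvdzP; exists (x * k.*2.+1%:Z + B n).
rewrite -[_ *+ 8]mulr_natr -[_ *+ e]mulr_natr -[_ *+ k.*2.+1]mulr_natr !natz !PoszM; ring.
Qed.

(** * Divisor sums *)

Lemma dil_logder (f g : pser) k c : qderiv f = f * g *+ c ->
  qderiv (dil k f) = dil k f * dil k g *+ (c * k.+1).
Proof. by move=> H; rewrite qderiv_dil H rmorphMn rmorphM /= mulrnA. Qed.

Lemma S_even n : ~~ odd n -> Sser n = 0.
Proof. by rewrite /Sser => /negPf ->. Qed.

(** D_2 = O_2 D_4, where O_2 contributes 4 S(q^2) and D_4 contributes 4 L(q^4), L being the
    logarithmic derivative of D. Only the fact that the latter is a series in q^4 is used later. *)
Lemma qderiv_D1 : exists L, qderiv (dil 1 Dser) = dil 1 Dser * (dil 1 Sser + dil 3 L) *+ 4.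
Proof.
exists (negs phi * qderiv Dser).
have HD : qderiv Dser = Dser * (negs phi * qderiv Dser) *+ 1.
  by rewrite mulr1n mulrA [Dser * _]mulrC gauss_phi mul1r.
have E : dil 1 Dser = dil 1 Oser * dil 3 Dser by rewrite {1}D_O rmorphM /= dil_dil.
rewrite E qderivM (dil_logder 3 HD) (dil_logder 1 qderiv_O) mul1n.
move: (negs phi * _) => L; ring.
Qed.

(* Both sides come from applying q d/dq to O(q) - O(-q), using q dO/dq = 2 S O. *)
Lemma S_identity : exists L,
  dil 3 phi * Sser = qderiv uodd + uodd * (dil 1 Sser + dil 3 L) *+ 4.
Proof.
have [L HL] := qderiv_D1; exists L.
have D0 : (dil 1 Dser) 0%N = 1 by rewrite dil0; apply: iprod0.
apply: (mulIs D0); apply: (@mulrn_injs 4) => //.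
have H2 : qderiv (negs Oser) = - (negs Oser * Sser *+ 2).
  by rewrite qderiv_negs qderiv_O rmorphMn rmorphM /= (negs_odd S_even); ring.
transitivity (qderiv (Oser - negs Oser)).
  rewrite qderivD qderivN H2 qderiv_O.
  transitivity (Sser * (dil 3 phi * dil 1 Dser *+ 2) *+ 2); first by ring.
  by rewrite -O_add; ring.
by rewrite O_sub qderivMn qderivM HL; ring.
Qed.

Lemma qderiv_graded m a f : graded m a f -> graded m a (qderiv f).
Proof. by move=> H n Hn; rewrite /qderiv H ?mul0rn. Qed.

(** This is 1/phi(q^4), because D(-q) inverts phi. *)
Definition Kser : pser := dil 3 (negs Dser).

Lemma K_phi : Kser * dil 3 phi = 1.
Proof.
rewrite /Kser -rmorphM -(rmorph1 (dil 3)); congr (dil 3 _).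
by rewrite -[phi]negsK -rmorphM mulrC gauss_phi rmorph1.
Qed.

Lemma K_split : Kser = (dil 15 phi - dil 3 uodd *+ 2) * dil 7 Dser ^+ 2.
Proof.
rewrite /Kser {1}D_phi rmorphM rmorphXn /= negs_dil1 negs_phi.
by rewrite rmorphM rmorphB rmorphXn rmorphMn /= !dil_dil.
Qed.

Lemma K_mod2 : eqmod 2 Kser 1.
Proof. by apply: eqmod1_dil; have := eqmod_negs D_mod2; rewrite rmorph1. Qed.

Lemma K_graded : graded 4 0 Kser.
Proof. exact: graded_dil0. Qed.

Lemma S_solved : exists L, Sser = Kser * qderiv uodd + Kser * uodd * dil 3 L *+ 4
   + Kser * uodd * dil 1 Sser *+ 4.
Proof.
have [L HL] := S_identity; exists L.
transitivity (Kser * (dil 3 phi * Sser)); first by rewrite mulrA K_phi mul1r.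
by rewrite HL; ring.
Qed.

(** Classically, sigma(n) for odd n is odd exactly at squares. Here K = 1 modulo 2, and q d/dq fixes
    u modulo 2 because its exponents are odd. *)
Lemma S_mod2 : eqmod 2 Sser uodd.
Proof.
have [L HL] := S_solved.
have T : eqmod 2 (qderiv uodd) uodd.
  exists (fun n => if odd n then uodd n *+ n./2 else 0); apply/funext => n.
  rewrite coefDs coefMns /qderiv; case: ifP => [on|/negbT en]; last by rewrite uodd_even ?mul0rn.
  by rewrite -{2}[n]odd_double_half on -muln2 mulrnDr mulr1n mulrnA.
have := eqmodM K_mod2 T; rewrite mul1r; apply: eqmod_trans.
by rewrite {1}HL; exists (Kser * uodd * dil 1 Sser *+ 2 + Kser * uodd * dil 3 L *+ 2); ring.
Qed.

(** K and L(q^4) are series in q^4 and u has exponents 1 modulo 4, so only the term with S(q^2)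
    reaches the class 3. *)
Lemma S_3mod4 n : n = 3 %[mod 4] -> Sser n = (Kser * uodd * dil 1 Sser) n *+ 4.
Proof.
move=> Hn; have [L HL] := S_solved.
have u4 := graded84 uodd_graded.
have G1 : graded 4 1 (Kser * qderiv uodd).
  exact: (gradedM K_graded (qderiv_graded u4)).
have G2 : graded 4 1 (Kser * uodd * dil 3 L *+ 4).
  apply: gradedMn; exact: (gradedM (gradedM K_graded u4) (@graded_dil0 3 L)).
by rewrite {1}HL (coef_peel _ G1 G2) ?Hn // coefMns.
Qed.

(** By [S_3mod4] it suffices to know K u S(q^2) modulo 4. There S may be replaced by its part [Sa]
    in the class 1 modulo 4, the rest being divisible by 4 by the same lemma. With K = (phi_16 - 2
    u_4) D_8^2, the phi_16 term lies in the class 3 modulo 8, and the other is -2 R modulo 4 because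
    [Sa] is u modulo 2. *)
Lemma S_7mod8 n : n = 7 %[mod 8] -> (16 %| Sser n - 8 * Rser n)%Z.
Proof.
move=> Hn; have Hn4 : n = 3 %[mod 4] by rewrite -(@modn_dvdm 8) // Hn.
pose Sa : pser := fun n => if (n %% 4 == 1)%N then Sser n else 0.
have Ga : graded 4 1 Sa by move=> j Hj; rewrite /Sa ifF //; apply/negbTE.
have [T HT] : exists T, Sser = Sa + T *+ 4.
  exists (fun j => ((Sser j - Sa j) %/ 4)%Z); apply/funext => j.
  rewrite coefDs coefMns /Sa -[_ *+ 4]mulr_natr; case: ifP => [|/negbT j1].
    by rewrite subrr div0z mul0r addr0.
  rewrite subr0 add0r; have [oj|ej] := boolP (odd j); last by rewrite S_even // div0z mul0r.
  have j3 : j = 3 %[mod 4].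
    have := @odd_mod j 4 erefl; rewrite oj.
    by have := ltn_pmod j (isT : 0 < 4)%N; case: (j %% 4)%N j1 => [|[|[|[|]]]].
  by rewrite S_3mod4 // -[_ *+ 4]mulr_natr mulzK.
have [h Hh] : eqmod 2 Sa uodd.
  apply: eqmod_trans S_mod2; apply: eqmod_sym; exists (T *+ 2); rewrite {1}HT; ring.
rewrite S_3mod4 // {1}HT rmorphD rmorphMn /= K_split.
set V := dil 15 phi; set E := dil 7 Dser; set S1 := dil 1 Sa.
have HS1 : S1 = dil 1 uodd + dil 1 h *+ 2 by rewrite /S1 Hh rmorphD rmorphMn.
have [x Hx] : eqmod 2 (E ^+ 2) 1 by apply: eqmod1X; apply: eqmod1_dil; exact: D_mod2.
have G : graded 8 3 (uodd * S1 * (V * E ^+ 2)).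
  apply: (gradedM (a := 3) (b := 0)); first exact: (gradedM uodd_graded (graded_dil (k := 1) Ga)).
  by rewrite /V /E; grade0.
have [B ->] : exists B, (V - dil 3 uodd *+ 2) * E ^+ 2 * uodd * (S1 + dil 1 T *+ 4) =
  uodd * S1 * (V * E ^+ 2) + (B *+ 4 - Rser *+ 2).
  exists ((V - dil 3 uodd *+ 2) * E ^+ 2 * uodd * dil 1 T
     - (Rser * x + dil 3 uodd * uodd * dil 1 h * (1 + x *+ 2))).
  transitivity (uodd * S1 * (V * E ^+ 2) - (dil 3 uodd * uodd * S1 * E ^+ 2) *+ 2
    + ((V - dil 3 uodd *+ 2) * E ^+ 2 * uodd * dil 1 T) *+ 4); first by ring.
  move: (_ * dil 1 T) (uodd * S1 * (V * E ^+ 2)) => F1 F2.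
  by rewrite HS1 Hx /Rser; ring.
rewrite coefDs (coef_graded0 G) ?Hn // add0r coefBs !coefMns.
apply/dvdzP; exists (B n - Rser n).
rewrite -[_ *+ 2]mulr_natr -[B n *+ 4]mulr_natr -[_ *+ 4]mulr_natr; ring.
Qed.

Lemma sigma_7mod8_c4 n : (16 %| (sigma (8 * n + 7))%:Z - 8 * c4 n)%Z.
Proof.
have H : (8 * n + 7 = 7 %[mod 8])%N by rewrite mulnC modnMDl.
have := S_7mod8 H; have := Rser_c4 n; rewrite /Sser ifT; last first.
  by rewrite oddD oddM.
by move=> /dvdzP[x Hx] /dvdzP[y Hy]; apply/dvdzP; exists (y + x); lia.
Qed.

Lemma sigma_3mod4 n : n = 3 %[mod 4] -> (4 %| sigma n)%N.
Proof.
move=> Hn; have on : odd n by rewrite -(@odd_mod n 4) // Hn.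
have := S_3mod4 Hn; rewrite /Sser on -[_ *+ 4]mulr_natr => E.
have : (4 %| (sigma n)%:Z)%Z by rewrite E; apply: dvdz_mull.
by [].
Qed.

Lemma sigma_7mod8 n : n = 7 %[mod 8] -> (8 %| sigma n)%N.
Proof.
move=> Hn; have on : odd n by rewrite -(@odd_mod n 8) // Hn.
have := S_7mod8 Hn; rewrite /Sser on => /dvdzP[x Hx].
have : (8 %| (sigma n)%:Z)%Z by apply/dvdzP; exists (x * 2 + Rser n); lia.
by [].
Qed.

Lemma sigma_5mod8 n : n = 5 %[mod 8] -> (2 %| sigma n)%N.
Proof.
move=> Hn; have on : odd n by rewrite -(@odd_mod n 8) // Hn.
have := eqmod_coef n S_mod2; rewrite /Sser on (coef_graded0 uodd_graded) ?Hn // subr0.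
by [].
Qed.

(** * Prime powers *)

(** A common bound [B] lets divisor sums of different integers be compared term by term; d = 0
    contributes 0. *)
Lemma sigmaE (B n : nat) : (0 < n)%N -> (n <= B)%N ->
  (sigma n)%:Z = \sum_(d < B.+1) (if (d %| n)%N then d%:Z else 0).
Proof.
move=> n0 nB; rewrite -(big_mkord xpredT (fun d => if (d %| n)%N then d%:Z else 0)).
rewrite big_ltn // if_same add0r /sigma (big_morph Posz PoszD (erefl _)) big_mkcond /=.
rewrite [RHS](@big_cat_nat _ _ _ n.+1) //= [X in _ = _ + X]big1_seq ?addr0 // => d.
by rewrite mem_index_iota => /andP[_ /andP[nd _]]; rewrite gtnNdvd.
Qed.

(** Divisors of p^(a+1) M prime to p are the divisors of M; the others are p times the divisors of
    p^a M. *)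
Lemma sigma_primeM (p a M : nat) : prime p -> (0 < M)%N -> ~~ (p %| M)%N ->
  sigma (p ^ a.+1 * M) = (sigma M + p * sigma (p ^ a * M))%N.
Proof.
move=> pp M0 pM; have p0 := prime_gt0 pp.
have n0 : (0 < p ^ a * M)%N by rewrite muln_gt0 expn_gt0 p0.
set n := (p ^ a * M)%N in n0 *.
have En : (p ^ a.+1 * M = n * p)%N by rewrite expnS -mulnA mulnC.
have np0 : (0 < n * p)%N by rewrite muln_gt0 n0.
have Mn : (M <= n * p)%N by rewrite -En leq_pmull // expn_gt0 p0.
apply/eqP; rewrite En -eqz_nat PoszD PoszM (sigmaE np0 (leqnn _)) (sigmaE M0 Mn) (sigmaE n0 (leqnn _)).
have SM := sum_multiples p.-1 n (fun d => p%:Z * (if (d %| n)%N then d%:Z else 0)).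
rewrite (prednK p0) in SM.
rewrite big_distrr /= -SM -big_split /=; apply/eqP; apply: eq_bigr => -[/= d _] _.
case: (boolP (p %| d)%N) => [/dvdnP[e ->]|pd].
  rewrite mulnK // dvdn_pmul2r // (_ : (e * p %| M)%N = false) ?add0r.
    by case: ifP; rewrite ?mulr0 // PoszM mulrC.
  by apply: contraNF pM; apply: dvdn_trans; apply: dvdn_mull.
rewrite addr0 -En Gauss_dvdr // coprime_sym; apply: coprimeXl.
by rewrite prime_coprime.
Qed.

Lemma sigma_step (p a M : nat) : prime p -> (0 < M)%N -> ~~ (p %| M)%N ->
  sigma (p ^ (a + 4) * M) =
    ((1 + p + p ^ 2 + p ^ 3) * sigma M + p ^ 4 * sigma (p ^ a * M))%N.
Proof. by move=> pp M0 pM; rewrite addn4 !sigma_primeM //; ring. Qed.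

(** For p = 1, 3, 5, 7 modulo 8, (1 + p)(1 + p^2) is divisible by 4, 8, 4, 16; correspondingly M =
    7, 5, 3, 1 modulo 8, and sigma(M) is divisible by 8, 2, 4, 1. *)
Lemma sigma_dvd16 (p k M : nat) : prime p -> (0 < M)%N -> ~~ (p %| M)%N ->
  odd p -> p * M = 7 %[mod 8] -> (16 %| sigma (p ^ (4 * k + 3) * M))%N.
Proof.
move=> pp M0 pM op Hm.
have H : (16 %| (1 + p + p ^ 2 + p ^ 3) * sigma M)%N.
  have -> : (1 + p + p ^ 2 + p ^ 3 = (1 + p) * (1 + p ^ 2))%N by ring.
  have Hp : (p %% 8 = 1 \/ p %% 8 = 3 \/ p %% 8 = 5 \/ p %% 8 = 7)%N.
    have := @odd_mod p 8 erefl; rewrite op.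
    by have := ltn_pmod p (isT : 0 < 8)%N; move: (p %% 8)%N => [|[|[|[|[|[|[|[|]]]]]]]] // _ _; tauto.
  have E := divn_eq p 8; set r := (p %/ 8)%N in E.
  move: Hm; rewrite -modnMm => Hm.
  have HM : (M %% 8 < 8)%N by exact: ltn_pmod.
  case: Hp => [|[|[|]]] Hp; rewrite Hp in E Hm.
  - have /sigma_7mod8/dvdnP[s ->] : M = 7 %[mod 8].
      by move: HM Hm; case: (M %% 8)%N => [|[|[|[|[|[|[|[|]]]]]]]].
    by rewrite E; apply/dvdnP; exists ((4 * r + 1) * (32 * r * r + 8 * r + 1) * 2 * s)%N; ring.
  - have /sigma_5mod8/dvdnP[s ->] : M = 5 %[mod 8].
      by move: HM Hm; case: (M %% 8)%N => [|[|[|[|[|[|[|[|]]]]]]]].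
    by rewrite E; apply/dvdnP; exists ((2 * r + 1) * (32 * r * r + 24 * r + 5) * s)%N; ring.
  - have M3 : M = 3 %[mod 8].
      by move: HM Hm; case: (M %% 8)%N => [|[|[|[|[|[|[|[|]]]]]]]].
    have /sigma_3mod4/dvdnP[s ->] : M = 3 %[mod 4] by rewrite -(@modn_dvdm 8) // M3.
    by rewrite E; apply/dvdnP; exists ((4 * r + 3) * (32 * r * r + 40 * r + 13) * s)%N; ring.
  by rewrite E; apply/dvdnP; exists ((r + 1) * (32 * r * r + 56 * r + 25) * sigma M)%N; ring.
elim: k => [|k IH]; last first.
  rewrite (_ : 4 * k.+1 + 3 = 4 * k + 3 + 4)%N; last by lia.
  by rewrite sigma_step // dvdn_add // dvdn_mull.
have := sigma_primeM 2 pp M0 pM; have := sigma_primeM 1 pp M0 pM.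
have := sigma_primeM 0 pp M0 pM; rewrite expn0 mul1n muln0 add0n => -> -> ->.
by move: H; congr (_ %| _)%N; ring.
Qed.

(* Hence nu p = 4 for every odd prime p, and the second half of the theorem is vacuous. *)
Lemma kappa_even (p : nat) : prime p -> (3 <= p)%N -> (2 %| kappa p)%Z.
Proof.
move=> pp p3; have op : odd p by case: (even_prime pp) => // E; move: p3; rewrite E.
have [j Ej] : exists j, (p ^ 2 = 8 * j + 1)%N.
  have := odd_double_half p; rewrite op; set h := p./2 => Eh.
  have [t Et] : exists t, (h * h.+1 = t * 2)%N.
    by apply/dvdnP; rewrite dvdn2 oddM /= andbN.
  by exists t; rewrite -Eh; nia.
have E7 : (7 * (p ^ 2 - 1) %/ 8 = 7 * j)%N.
  by rewrite Ej addnK mulnCA mulKn.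
have E14 : (7 * (p ^ 2 - 1) %/ 4 = 14 * j)%N.
  by rewrite Ej addnK (_ : 7 * (8 * j) = 14 * j * 4)%N ?mulnK //; lia.
rewrite /kappa E7 E14.
have Hs := sigma_7mod8_c4 (7 * j).
have EN : (8 * (7 * j) + 7 = p ^ 2 * 7)%N by rewrite Ej; lia.
rewrite EN in Hs.
have s1 : sigma 1 = 1%N by rewrite /sigma big_mkcond big_nat1.
have s7 : sigma 7 = 8%N.
  by have := sigma_primeM 0 (isT : prime 7) (isT : 0 < 1)%N isT; rewrite !s1.
(* For p = 7, sigma(7^3) = 400 = 8 * 50 makes the c_4 term even, and the Legendre symbol is 0. *)
have [E|p7] := eqVneq p 7%N.
  have s343 : sigma (7 ^ 2 * 7) = 400%N.
    have P a := sigma_primeM a (isT : prime 7) (isT : 0 < 1)%N isT.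
    by have := P 2; rewrite -[(7 ^ 3 * 1)%N]/(7 ^ 2 * 7)%N => ->; rewrite !P s1.
  rewrite E in Hs Ej *; rewrite s343 in Hs.
  have -> : legendre (- (14 * j)%N%:Z) 7 = 0.
    rewrite /legendre ifT //; apply/dvdzP; exists (- (2 * j)%N%:Z); lia.
  move/dvdzP: Hs => [x Hx]; apply/dvdzP; exists (25 - x); lia.
have p_7 : ~~ (p %| 7)%N by rewrite dvdn_prime2.
have Es : sigma (p ^ 2 * 7) = (8 * (1 + p + p ^ 2))%N.
  rewrite (sigma_primeM 1 pp) // (sigma_primeM 0 pp) // expn0 mul1n s7; ring.
rewrite Es in Hs.
(* The symbol is odd: 4 * 14 j + 7 = 7 p^2, so p dividing 14 j would divide 7. It balances c_4,
   which has the parity of 1 + p + p^2. *)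
have [e El] : exists e : int, legendre (- (14 * j)%N%:Z) p = e * 2 + 1.
  rewrite /legendre ifF; last first.
    apply/negbTE; rewrite dvdzE abszN /=; apply: contra p_7 => H.
    have : (p %| 4 * (14 * j) + 7)%N by rewrite (_ : 4 * (14 * j) + 7 = p ^ 2 * 7)%N ?dvdn_mulr ?dvdn_exp //; lia.
    by rewrite dvdn_addr // dvdn_mull.
  by case: ifP => _; [exists 0|exists (-1)].
rewrite El; have [h Eh] : exists h, p = (h * 2 + 1)%N.
  by exists p./2; have := odd_double_half p; rewrite op; lia.
move/dvdzP: Hs => [x Hx]; apply/dvdzP.
have E4 : (p ^ 4 = (8 * j + 1) * (8 * j + 1))%N by rewrite (expnM p 2 2) Ej; ring.
have -> : p%:Z ^+ 4 = ((8 * j + 1) * (8 * j + 1))%N%:Z by rewrite -E4 -!natz natrX.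
have -> : c4 (7 * j)%N = (1 + p + p ^ 2)%N%:Z - 2 * x by lia.
rewrite Ej Eh; exists (2 + h%:Z + 12 * j%:Z - x + (8 * j%:Z + 1) ^+ 2 * e + 32 * j%:Z ^+ 2).
rewrite !PoszD !PoszM; ring.
Qed.

Lemma Rser_even n : n = 7 %[mod 8] -> (16 %| sigma n)%N -> (2 %| Rser n)%Z.
Proof.
move=> Hn /dvdnP[s Hs]; have on : odd n by rewrite -(@odd_mod n 8) // Hn.
have := S_7mod8 Hn; rewrite /Sser on Hs => /dvdzP[x Hx].
by apply/dvdzP; exists (s%:Z - x); lia.
Qed.

Local Close Scope ring_scope.

Theorem theorem1p12 (m alpha beta p : nat)
    (hm : 1 <= m) (halpha : 1 <= alpha) (hbeta : 1 <= beta)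
    (halpha_odd : ~~ (2 %| alpha))
    (hp : prime p) (hp3 : 3 <= p) :
  (forall n k : nat, ~~ (p %| n) ->
     abar (2 ^ m * alpha)
       (8 * p ^ (nu p * (k + 1) - 1) * n + 7 * p ^ (nu p * (k + 1)))
       = 0 %[mod 2 ^ (m + 4)]
     /\
     abar (2 * beta + 1)
       (8 * p ^ (nu p * (k + 1) - 1) * n + 7 * p ^ (nu p * (k + 1)))
       = 0 %[mod 128])
  /\
  ((kappa p = 1%:Z %[mod 2%:Z])%Z ->
   forall n k : nat, ~~ (p %| 8 * n + 7) ->
     abar (2 ^ m * alpha) (8 * p ^ (6 * k + 2) * n + 7 * p ^ (6 * k + 2))
       = 0 %[mod 2 ^ (m + 4)]
     /\
     abar (2 * beta + 1) (8 * p ^ (6 * k + 2) * n + 7 * p ^ (6 * k + 2))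
       = 0 %[mod 128]).
Proof.
have op : odd p by case: (even_prime hp) => // E; move: hp3; rewrite E.
have /dvdz_mod0P kap := kappa_even hp hp3.
split; last by rewrite kap.
have -> : nu p = 4 by rewrite /nu kap mod0z.
move=> n k pn.
(* The cofactor M = 8n + 7p is prime to p because p divides neither 8 nor n. As p^2 is 1 modulo 8
   and 4k+3 is odd, the whole argument is p M = 7 modulo 8. *)
have -> : 8 * p ^ (4 * (k + 1) - 1) * n + 7 * p ^ (4 * (k + 1))
  = p ^ (4 * k + 3) * (8 * n + 7 * p).
  have -> : 4 * (k + 1) - 1 = 4 * k + 3 by lia.
  have -> : 4 * (k + 1) = (4 * k + 3).+1 by lia.
  by rewrite expnS; ring.
have [j Ej] : exists j, p ^ 2 = 8 * j + 1.
  have := odd_double_half p; rewrite op; set h := p./2 => Eh.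
  have [t Et] : exists t, h * h.+1 = t * 2.
    by apply/dvdnP; rewrite dvdn2 oddM /= andbN.
  by exists t; rewrite -Eh; nia.
have pM : ~~ (p %| 8 * n + 7 * p).
  rewrite dvdn_addl; last exact: dvdn_mull.
  rewrite Gauss_dvdr //.
  by rewrite (_ : 8 = 2 ^ 3) // coprimeXr // coprimen2.
have HM : p * (8 * n + 7 * p) = 7 %[mod 8].
  rewrite (_ : p * (8 * n + 7 * p) = (p * n + 7 * j) * 8 + 7) ?modnMDl //.
  by have := Ej; rewrite expnS expn1; lia.
have HN : p ^ (4 * k + 3) * (8 * n + 7 * p) = 7 %[mod 8].
  rewrite (_ : 4 * k + 3 = (2 * (2 * k + 1)).+1); last by lia.
  rewrite expnSr expnM -mulnA -modnMm HM -modnXm Ej [8 * j]mulnC modnMDl exp1n.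
  by [].
have M0 : 0 < 8 * n + 7 * p by lia.
have /dvdzP[r Hr] := Rser_even HN (sigma_dvd16 k hp M0 pM op HM).
split; apply/eqP; rewrite mod0n.
  have -> : alpha = alpha./2.*2.+1.
    by rewrite -[LHS]odd_double_half -[odd _]negbK -dvdn2 halpha_odd.
  case: m hm => // m' _; have := abar_even m' alpha./2 HN.
  rewrite Hr => /dvdzP[x Hx].
  suff : (Posz (2 ^ (m'.+1 + 4)) %| Posz (abar (2 ^ m'.+1 * alpha./2.*2.+1) (p ^ (4 * k + 3) * (8 * n + 7 * p))))%Z by [].
  apply/dvdzP; exists (x + alpha./2.*2.+1%:Z * r)%R.
  move: Hx; rewrite (addn4 m'.+1) (addn3 m'.+1) (expnS 2 m'.+1.+3) PoszM => Hx.
  by rewrite -[LHS](subrK (Posz (2 ^ m'.+1.+3) * alpha./2.*2.+1%:Z * (r * 2))%R) Hx; ring.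
have -> : 2 * beta + 1 = beta.*2.+1 by lia.
have := abar_odd beta HN; rewrite Hr => /dvdzP[x Hx].
suff : (128 %| Posz (abar beta.*2.+1 (p ^ (4 * k + 3) * (8 * n + 7 * p))))%Z by [].
by apply/dvdzP; exists (x + beta.*2.+1%:Z * r)%R; lia.
Qed.
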